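(* Uniformly in the parameter $c\in \mathrm{CompStr}$ and an encoding of a computable set $\Phi$ of quantifier-free first-order $\mathcal{L}_c$-formulas, the set $\mathrm{dcl}_{\Phi, c}$ is $\Sigma^0_1$ in $\mathrm{DCL}^c_0$. In particular, $\mathrm{dcl}_{\Phi, c}$ is a $\Sigma^0_2$ set.
   Context: Computable structures. Languages are relational and may be many-sorted: $\mathcal{L} = ((X_j)_{j\in J}, (R_i)_{i\in I})$ with sorts $X_j$ and relation symbols $R_i$, where $I,J\in\mathbb{N}\cup\{\mathbb{N}\}$ (a natural number is identified with the set of its predecessors). The type of a tuple of elements or variables is the product of the sorts of its entries, in order; the type of a relation symbol is a finite product of sorts. $\mathcal{L}$ is computable when the function sending $i\in I$ to $(j_0,\dots,j_{m-1})$, where $R_i$ has type $\prod_{k<m}X_{j_k}$, is computable; for each computable language a computable encoding of its first-order formulas is fixed. A computable $\mathcal{L}$-structure $\mathcal{N}$ has a computable underlying set, and $\{(a,j) : a\in (X_j)^{\mathcal{N}}\}$ and $\{(\overline{b},i) : \overline{b}\in (R_i)^{\mathcal{N}}\}$ are computable. Writing $\{e\}$ for the $e$th Turing machine, $c\in\mathbb{N}$ is a code for a structure if $\{c\}(0)$ is a code for a computable language, denoted $\mathcal{L}_c$, and $\{c\}(1)$ is a code for a computable $\mathcal{L}_c$-structure, denoted $\mathcal{M}_c$. $\mathrm{CompStr}$ is the set of all codes for structures. Formulas $\varphi(\overline{x};\overline{y})$ come with a specified partition of their free variables; a set of formulas is a set of formulas with specified partitions. $\mathrm{DCL}^c_0$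 is the set of pairs $(\varphi(\overline{x};\overline{y}),\overline{a})$ such that $\varphi$ is a quantifier-free first-order $\mathcal{L}_c$-formula, $\overline{a}\in\mathcal{M}_c$ has the same type as $\overline{x}$, and $\{\overline{b}\in\mathcal{M}_c : \mathcal{M}_c\models\varphi(\overline{a};\overline{b})\}$ is a singleton. For $B\subseteq\mathcal{M}_c$, let $\mathrm{cl}^0(B):=B$; let $\mathrm{cl}^1(B)$ be $B$ together with all $b\in\mathcal{M}_c$ for which there are $\varphi(\overline{x};\overline{y})\in\Phi$ and a tuple $\overline{a}$ from $B$ such that $|\{\overline{d} : \mathcal{M}_c\models\varphi(\overline{a};\overline{d})\}|=1$, and a tuple $\overline{b}\in\mathcal{M}_c$ having $b$ as an entry with $\mathcal{M}_c\models\varphi(\overline{a};\overline{b})$; let $\mathrm{cl}^{m+1}(B):=\mathrm{cl}^1(\mathrm{cl}^m(B))$; and let $\mathrm{dcl}_{\Phi,c}(B):=\bigcup_m\mathrm{cl}^m(B)$. Then, as a set, $\mathrm{dcl}_{\Phi,c}:=\{(a,A) : A\subseteq\mathcal{M}_c\text{ finite},\ a\in\mathrm{dcl}_{\Phi,c}(A)\}$. ''Uniformly in'' the parameters means that the description (index) of the set at the stated level is obtained computably from $c$ and the encoding of $\Phi$. *)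

(* Defs.v *)
From Stdlib Require Import Arith List.
From Stdlib Require Cantor.
Import ListNotations.

Definition pair_code (x y : nat) : nat := Cantor.to_nat (x, y).

Fixpoint list_code (l : list nat) : nat :=
  match l with
  | [] => 0
  | x :: l' => S (pair_code x (list_code l'))
  end.

(** Oracle programs compute partial functions from nat to nat by Kleene's
    schemes; inputs and outputs with several components are Cantor pairs. *)
Inductive program : Type :=
| PZero
| PSucc
| PFst
| PSnd
| PQuery
| PPair (p q : program)
| PComp (p q : program)
| PRec (p q : program)
| PMin (p : program).

(** Graph of h with h(a,0) = F(a) and h(a,n+1) = G(a,(n,h(a,n))). *)
Fixpoint rec_graph (F G : nat -> nat -> Prop) (a n y : nat) : Prop :=
  match n with
  | 0 => F a y
  | S n' => exists r,
      rec_graph F G a n' r /\ G (pair_code a (pair_code n' r)) y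
  end.

(** [eval O p x y]: with oracle [O], program [p] halts on [x] with output [y].
    [PQuery] is the characteristic function of the oracle. *)
Fixpoint eval (O : nat -> Prop) (p : program) (x y : nat) : Prop :=
  match p with
  | PZero => y = 0
  | PSucc => y = S x
  | PFst => y = fst (Cantor.of_nat x)
  | PSnd => y = snd (Cantor.of_nat x)
  | PQuery => (O x /\ y = 1) \/ (~ O x /\ y = 0)
  | PPair q r => exists u v, eval O q x u /\ eval O r x v /\ y = pair_code u v
  | PComp q r => exists z, eval O r x z /\ eval O q z y
  | PRec q r =>
      rec_graph (eval O q) (eval O r)
        (fst (Cantor.of_nat x)) (snd (Cantor.of_nat x)) y
  | PMin q =>
      eval O q (pair_code x y) 0 /\
      forall m, m < y -> exists k, eval O q (pair_code x m) (S k)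
  end.

Fixpoint program_code (p : program) : nat :=
  match p with
  | PZero => pair_code 0 0
  | PSucc => pair_code 1 0
  | PFst => pair_code 2 0
  | PSnd => pair_code 3 0
  | PQuery => pair_code 4 0
  | PPair q r => pair_code 5 (pair_code (program_code q) (program_code r))
  | PComp q r => pair_code 6 (pair_code (program_code q) (program_code r))
  | PRec q r => pair_code 7 (pair_code (program_code q) (program_code r))
  | PMin q => pair_code 8 (program_code q)
  end.

(** {e}^O(x) = y.  A number that is not the code of a program indexes the
    nowhere defined function. *)
Definition run_oracle (O : nat -> Prop) (e x y : nat) : Prop :=
  exists p, program_code p = e /\ eval O p x y.

Definition no_oracle : nat -> Prop := fun _ => False.

(** {e}(x) = y *)
Definition run (e x y : nat) : Prop := run_oracle no_oracle e x y.

Definition computable2 (f : nat -> nat -> nat) : Prop :=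
  exists e, forall x y, run e (pair_code x y) (f x y).

Definition decides (O : nat -> Prop) (e : nat) (S : nat -> Prop) : Prop :=
  forall n, (S n -> run_oracle O e n 1) /\ (~ S n -> run_oracle O e n 0).

(** [n] alternating quantifiers in front of [R], the outermost one existential
    if [ex] is true; the quantified numbers are paired onto the argument. *)
Fixpoint alternate (ex : bool) (n : nat) (R : nat -> Prop) (x : nat) : Prop :=
  match n with
  | 0 => R x
  | S n' =>
      if ex then exists y, alternate false n' R (pair_code x y)
      else forall y, alternate true n' R (pair_code x y)
  end.

(** [e] is an index of [S] as a Sigma^0_n set relative to [O]. *)
Definition sigma_index (O : nat -> Prop) (n e : nat) (S : nat -> Prop) : Prop :=
  exists R, decides O e R /\ forall x, S x <-> alternate true n R x.

(** [None] stands for the index set of all natural numbers, [Some n] for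
    {0,...,n-1}. *)
Definition below (b : option nat) (k : nat) : Prop :=
  match b with
  | None => True
  | Some n => k < n
  end.

Definition bound_code (b : option nat) : nat :=
  match b with
  | None => 0
  | Some n => S n
  end.

(** The values of [rel_type] outside the index set of the relation symbols are
    irrelevant. *)
Record language : Type := Language {
  sort_bound : option nat;
  rel_bound : option nat;
  rel_type : nat -> list nat
}.

Definition language_wf (L : language) : Prop :=
  forall i, below (rel_bound L) i -> Forall (below (sort_bound L)) (rel_type L i).

Definition language_code (l : nat) (L : language) : Prop :=
  language_wf L /\
  exists t,
    l = pair_code (pair_code (bound_code (sort_bound L)) (bound_code (rel_bound L))) t /\
    forall i, below (rel_bound L) i -> run t i (list_code (rel_type L i)).

Record structure : Type := Structure {
  univ : nat -> Prop;
  has_sort : nat -> nat -> Prop;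
  rel : nat -> list nat -> Prop
}.

(** The sorts partition the underlying set. *)
Record structure_wf (L : language) (M : structure) : Prop := {
  sort_sound : forall a j, has_sort M a j -> univ M a /\ below (sort_bound L) j;
  sort_unique : forall a, univ M a -> exists! j, has_sort M a j;
  rel_sound : forall i b, rel M i b ->
    below (rel_bound L) i /\ Forall2 (has_sort M) b (rel_type L i)
}.

Definition structure_code (L : language) (d : nat) (M : structure) : Prop :=
  structure_wf L M /\
  exists u s r,
    d = pair_code u (pair_code s r) /\
    decides no_oracle u (univ M) /\
    decides no_oracle s (fun n => exists a j, n = pair_code a j /\ has_sort M a j) /\
    decides no_oracle r (fun n => exists b i, n = pair_code (list_code b) i /\ rel M i b).

(** [c] is in CompStr, with L_c = [L] and M_c = [M]. *)
Definition CompStr (c : nat) (L : language) (M : structure) : Prop :=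
  exists l d, run c 0 l /\ run c 1 d /\ language_code l L /\ structure_code L d M.

(** [(j, k)] is the k-th variable of sort j. *)
Definition var : Type := (nat * nat)%type.

Definition var_eqb (v w : var) : bool :=
  Nat.eqb (fst v) (fst w) && Nat.eqb (snd v) (snd w).

Inductive formula : Type :=
| Eq (v w : var)
| Rel (i : nat) (vs : list var)
| Neg (f : formula)
| And (f g : formula)
| Or (f g : formula)
| Imp (f g : formula)
| All (v : var) (f : formula)
| Ex (v : var) (f : formula).

Fixpoint formula_wf (L : language) (f : formula) : Prop :=
  match f with
  | Eq v w => fst v = fst w /\ below (sort_bound L) (fst v)
  | Rel i vs => below (rel_bound L) i /\ map fst vs = rel_type L i
  | Neg g => formula_wf L g
  | And g h | Or g h | Imp g h => formula_wf L g /\ formula_wf L h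
  | All v g | Ex v g => below (sort_bound L) (fst v) /\ formula_wf L g
  end.

Fixpoint quantifier_free (f : formula) : Prop :=
  match f with
  | Eq _ _ | Rel _ _ => True
  | Neg g => quantifier_free g
  | And g h | Or g h | Imp g h => quantifier_free g /\ quantifier_free h
  | All _ _ | Ex _ _ => False
  end.

Fixpoint occurs_free (v : var) (f : formula) : Prop :=
  match f with
  | Eq w w' => v = w \/ v = w'
  | Rel _ vs => In v vs
  | Neg g => occurs_free v g
  | And g h | Or g h | Imp g h => occurs_free v g \/ occurs_free v h
  | All w g | Ex w g => v <> w /\ occurs_free v g
  end.

Definition update (s : var -> nat) (v : var) (a : nat) : var -> nat :=
  fun w => if var_eqb w v then a else s w.

Fixpoint sat (M : structure) (s : var -> nat) (f : formula) : Prop :=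
  match f with
  | Eq v w => s v = s w
  | Rel i vs => rel M i (map s vs)
  | Neg g => ~ sat M s g
  | And g h => sat M s g /\ sat M s h
  | Or g h => sat M s g \/ sat M s h
  | Imp g h => sat M s g -> sat M s h
  | All v g => forall a, has_sort M a (fst v) -> sat M (update s v a) g
  | Ex v g => exists a, has_sort M a (fst v) /\ sat M (update s v a) g
  end.

(** A formula phi(x;y) with a specified partition of its free variables. *)
Record pformula : Type := PFormula {
  body : formula;
  xvars : list var;
  yvars : list var
}.

Definition pformula_wf (L : language) (phi : pformula) : Prop :=
  formula_wf L (body phi) /\
  NoDup (xvars phi ++ yvars phi) /\
  forall v, In v (xvars phi ++ yvars phi) <-> occurs_free v (body phi).

Definition qf_pformula (L : language) (phi : pformula) : Prop :=
  pformula_wf L phi /\ quantifier_free (body phi).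

Definition var_code (v : var) : nat := pair_code (fst v) (snd v).

Definition vars_code (vs : list var) : nat := list_code (map var_code vs).

Fixpoint formula_code (f : formula) : nat :=
  match f with
  | Eq v w => pair_code 0 (pair_code (var_code v) (var_code w))
  | Rel i vs => pair_code 1 (pair_code i (vars_code vs))
  | Neg g => pair_code 2 (formula_code g)
  | And g h => pair_code 3 (pair_code (formula_code g) (formula_code h))
  | Or g h => pair_code 4 (pair_code (formula_code g) (formula_code h))
  | Imp g h => pair_code 5 (pair_code (formula_code g) (formula_code h))
  | All v g => pair_code 6 (pair_code (var_code v) (formula_code g))
  | Ex v g => pair_code 7 (pair_code (var_code v) (formula_code g))
  end.

Definition pformula_code (phi : pformula) : nat :=
  pair_code (formula_code (body phi))
    (pair_code (vars_code (xvars phi)) (vars_code (yvars phi))).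

(** [e] encodes the computable set [Phi] of quantifier-free [L]-formulas. *)
Definition formula_set_code (L : language) (e : nat) (Phi : pformula -> Prop) : Prop :=
  (forall phi, Phi phi -> qf_pformula L phi) /\
  decides no_oracle e (fun n => exists phi, n = pformula_code phi /\ Phi phi).

Definition same_type (M : structure) (a : list nat) (vs : list var) : Prop :=
  Forall2 (fun x v => has_sort M x (fst v)) a vs.

Fixpoint assignment (vs : list var) (a : list nat) : var -> nat :=
  match vs, a with
  | v :: vs', x :: a' => update (assignment vs' a') v x
  | _, _ => fun _ => 0
  end.

(** [b] belongs to the set defined by phi(a;y) in [M]. *)
Definition solution (M : structure) (phi : pformula) (a b : list nat) : Prop :=
  same_type M b (yvars phi) /\
  sat M (assignment (xvars phi ++ yvars phi) (a ++ b)) (body phi).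

Definition DCL0 (L : language) (M : structure) : nat -> Prop :=
  fun n => exists phi a,
    n = pair_code (pformula_code phi) (list_code a) /\
    qf_pformula L phi /\
    same_type M a (xvars phi) /\
    exists! b, solution M phi a b.

Definition cl1 (Phi : pformula -> Prop) (M : structure) (B : nat -> Prop) : nat -> Prop :=
  fun b => B b \/
    exists phi a,
      Phi phi /\ Forall B a /\ same_type M a (xvars phi) /\
      (exists! d, solution M phi a d) /\
      exists t, In b t /\ solution M phi a t.

Definition cl (Phi : pformula -> Prop) (M : structure) (m : nat) (B : nat -> Prop) :
    nat -> Prop :=
  Nat.iter m (cl1 Phi M) B.

Definition dcl (Phi : pformula -> Prop) (M : structure) (B : nat -> Prop) : nat -> Prop :=
  fun b => exists m, cl Phi M m B b.

(** The finite set with canonical index [u]. *)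
Definition fin_set (u : nat) : nat -> Prop := fun x => Nat.testbit u x = true.

Definition dcl_pairs (Phi : pformula -> Prop) (M : structure) : nat -> Prop :=
  fun n => exists a u,
    n = pair_code a u /\
    (forall x, fin_set u x -> univ M x) /\
    dcl Phi M (fin_set u) a.

(* Main.v *)
From Stdlib Require Import Arith List Lia Classical.
From Stdlib Require Cantor.
Import ListNotations.
Require Import Defs.

(** Membership of [a] in the closure of a finite set is witnessed by a finite
    derivation.  A step of the derivation adds an entry of a tuple [b] that
    solves phi(d;y), where phi is in Phi and [d] consists of elements obtained
    earlier.  Sorts and quantifier-free satisfaction are decidable in a
    computable structure, uniformly in its code, so everything about a step can
    be verified by a computation, except that [b] is the only solution.  That is
    one positive question to [DCL0].  Hence the closure is given by: there are a
    list [l] of questions and a derivation relying on no other uniqueness claims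
    than those in [l], such that the oracle accepts every entry of [l]
    ([dcl_iff_derives]).  The bound in the first half of the theorem is read off
    from this form ([sigma_index_1]).

    For the second half, the claim that phi(d;y) has exactly one solution says
    that some [b] is a solution and that no [b'] different from [b] is one.  Both
    being a solution and having a rival are semidecidable.  Because the questions
    are asked positively and there are finitely many of them, the candidates [b]
    can be quantified in front together with [l] ([all_ex_iff_all2]), which leaves
    a quantifier block exists-forall in front of a decidable matrix
    ([sigma_index_2]).

    The indices must be computed from the parameters alone, and the programs for
    the structure only become known by running the code [c].  So these programs
    have to be interpreted: [yields_eval] is the universal machine.  It is
    obtained, like satisfaction and the closure itself, as the least fixed point
    of a rule whose premises are finitely many: such a fixed point is
    semidecidable because a list of conclusions, each supported by those after
    it, is a checkable certificate ([sigma1_derivable]).  One program thus works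
    for all parameters and all oracles, and the s-m-n theorem ([hardwire]) turns
    the parameters into an index.

    Programs are written only for pairing, recursion, arithmetic and bounded
    quantification; all further relations are shown to be semidecidable by
    composing them from logical connectives. *)

(** * Pairs and coded lists *)

Notation "<| x , .. , y , z |>" :=
  (pair_code x .. (pair_code y z) ..) (at level 0).

Definition pi1 (n : nat) : nat := fst (Cantor.of_nat n).
Definition pi2 (n : nat) : nat := snd (Cantor.of_nat n).

Lemma pi1_pair x y : pi1 <|x, y|> = x.
Proof. unfold pi1, pair_code. now rewrite Cantor.cancel_of_to. Qed.

Lemma pi2_pair x y : pi2 <|x, y|> = y.
Proof. unfold pi2, pair_code. now rewrite Cantor.cancel_of_to. Qed.

Lemma pair_pi n : <|pi1 n, pi2 n|> = n.
Proof.
  unfold pi1, pi2, pair_code.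
  rewrite <- surjective_pairing. apply Cantor.cancel_to_of.
Qed.

Lemma pair_inj x y x' y' : <|x, y|> = <|x', y'|> -> x = x' /\ y = y'.
Proof.
  intros H. split.
  - rewrite <- (pi1_pair x y), H. apply pi1_pair.
  - rewrite <- (pi2_pair x y), H. apply pi2_pair.
Qed.

Lemma pair_ge_snd x y : y <= <|x, y|>.
Proof. pose proof (Cantor.to_nat_non_decreasing x y). unfold pair_code. lia. Qed.

Opaque pair_code.

Ltac pairs :=
  repeat (progress (subst; repeat match goal with
  | H : <|_, _|> = <|_, _|> |- _ =>
      apply pair_inj in H; destruct H; try discriminate
  end)).

Ltac unpair := repeat first [rewrite pi1_pair in * | rewrite pi2_pair in *].

Definition lhead (c : nat) : nat := pi1 (pred c).
Definition ltail (c : nat) : nat := pi2 (pred c).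
Definition ldrop (k c : nat) : nat := Nat.iter k ltail c.
Arguments ldrop : simpl never.

Lemma lhead_cons x c : lhead (S <|x, c|>) = x.
Proof. apply pi1_pair. Qed.

Lemma ltail_cons x c : ltail (S <|x, c|>) = c.
Proof. apply pi2_pair. Qed.

Lemma ldrop_zero c : ldrop 0 c = c.
Proof. reflexivity. Qed.

Lemma ldrop_cons k x c : ldrop (S k) (S <|x, c|>) = ldrop k c.
Proof. unfold ldrop. now rewrite Nat.iter_succ_r, ltail_cons. Qed.

Lemma ldrop_nil k : ldrop k 0 = 0.
Proof.
  induction k as [|k IH]; [reflexivity|].
  unfold ldrop in *. rewrite Nat.iter_succ, IH. reflexivity.
Qed.

Lemma list_code_surj c : exists l, c = list_code l.
Proof.
  induction c as [[|c] IH] using lt_wf_ind.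
  - now exists [].
  - destruct (IH (pi2 c)) as [l Hl].
    + pose proof (pair_ge_snd (pi1 c) (pi2 c)) as H.
      rewrite pair_pi in H. lia.
    + exists (pi1 c :: l). simpl. now rewrite <- Hl, pair_pi.
Qed.

Lemma list_code_inj l m : list_code l = list_code m -> l = m.
Proof.
  revert m; induction l as [|x l IH]; intros [|y m] H;
    try discriminate; [reflexivity|].
  injection H as H. pairs. f_equal. now apply IH.
Qed.

(** Positions at or beyond the code itself lie past the end of the list, so
    bounding a position by the code loses nothing. *)
Lemma ldrop_past_end c k : c <= k -> ldrop k c = 0.
Proof.
  destruct (list_code_surj c) as [l ->]. revert k.
  induction l as [|x l IH]; intros k Hk; [apply ldrop_nil|].
  simpl in Hk. pose proof (pair_ge_snd x (list_code l)).
  destruct k as [|k]; [lia|]. simpl. rewrite ldrop_cons. apply IH. lia.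
Qed.

Lemma lhead_ldrop_nth k l : lhead (ldrop k (list_code l)) = nth k l (lhead 0).
Proof.
  revert k; induction l as [|x l IH]; intros k.
  - simpl. rewrite ldrop_nil. now destruct k.
  - destruct k; simpl.
    + rewrite ldrop_zero. apply lhead_cons.
    + rewrite ldrop_cons. apply IH.
Qed.

Definition mem (x c : nat) : Prop :=
  exists k, ldrop k c <> 0 /\ lhead (ldrop k c) = x.

(** The graph of the finite map sending the entries of [c] to those of [d]. *)
Definition zip_mem (x y c d : nat) : Prop :=
  exists k, (ldrop k c <> 0 /\ ldrop k d <> 0) /\
    lhead (ldrop k c) = x /\ lhead (ldrop k d) = y.

Definition all_suffixes (Q : nat -> nat -> Prop) (c : nat) : Prop :=
  forall k, k < c ->
    ldrop k c = 0 \/ Q (lhead (ldrop k c)) (ltail (ldrop k c)).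

Definition all (Q : nat -> Prop) (c : nat) : Prop :=
  all_suffixes (fun x _ => Q x) c.

Definition all2 (Q : nat -> nat -> Prop) (c d : nat) : Prop :=
  forall k, k < c + d ->
    (ldrop k c = 0 /\ ldrop k d = 0) \/
    (ldrop k c <> 0 /\ ldrop k d <> 0) /\ Q (lhead (ldrop k c)) (lhead (ldrop k d)).

Lemma mem_code x l : mem x (list_code l) <-> In x l.
Proof.
  induction l as [|y l IH]; simpl.
  - split; [|tauto]. intros [k [H _]]. now rewrite ldrop_nil in H.
  - rewrite <- IH. split.
    + intros [[|k] H].
      * rewrite ldrop_zero, lhead_cons in H. tauto.
      * rewrite ldrop_cons in H. right. now exists k.
    + intros [->|[k H]].
      * exists 0. now rewrite ldrop_zero, lhead_cons.
      * exists (S k). now rewrite ldrop_cons.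
Qed.

Lemma zip_mem_code x y l m :
  zip_mem x y (list_code l) (list_code m) <-> In (x, y) (combine l m).
Proof.
  revert m; induction l as [|u l IH]; intros m; simpl.
  - split; [|tauto]. intros [k [[H _] _]]. now rewrite ldrop_nil in H.
  - destruct m as [|v m]; simpl.
    + split; [|tauto]. intros [k [[_ H] _]]. now rewrite ldrop_nil in H.
    + rewrite <- IH. split.
      * intros [[|k] H].
        -- rewrite !ldrop_zero, !lhead_cons in H.
           destruct H as [_ [-> ->]]. now left.
        -- rewrite !ldrop_cons in H. right. now exists k.
      * intros [E|[k H]].
        -- injection E as -> ->. exists 0. now rewrite !ldrop_zero, !lhead_cons.
        -- exists (S k). now rewrite !ldrop_cons.
Qed.

Lemma all_suffixes_nil Q : all_suffixes Q 0.
Proof. intros k Hk. lia. Qed.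

Lemma all_suffixes_cons Q x c :
  all_suffixes Q (S <|x, c|>) <-> Q x c /\ all_suffixes Q c.
Proof.
  split.
  - intros H. split.
    + destruct (H 0) as [E|E]; [lia|discriminate|].
      now rewrite ldrop_zero, lhead_cons, ltail_cons in E.
    + intros k Hk. pose proof (pair_ge_snd x c).
      specialize (H (S k)). rewrite ldrop_cons in H. apply H. lia.
  - intros [H0 H] [|k] _.
    + right. now rewrite ldrop_zero, lhead_cons, ltail_cons.
    + rewrite ldrop_cons. destruct (le_lt_dec c k) as [E|E].
      * left. now apply ldrop_past_end.
      * now apply H.
Qed.

Lemma all_code Q l : all Q (list_code l) <-> Forall Q l.
Proof.
  unfold all. induction l as [|x l IH]; simpl.
  - split; intros _; [constructor | apply all_suffixes_nil].
  - rewrite all_suffixes_cons, IH. split.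
    + intros []. now constructor.
    + intros H. now inversion H.
Qed.

Lemma all2_code Q l m :
  all2 Q (list_code l) (list_code m) <-> Forall2 Q l m.
Proof.
  (* Without the bound on the position the statement is invariant under
     shifting, which the induction needs. *)
  transitivity (forall k,
    (ldrop k (list_code l) = 0 /\ ldrop k (list_code m) = 0) \/
    (ldrop k (list_code l) <> 0 /\ ldrop k (list_code m) <> 0) /\
      Q (lhead (ldrop k (list_code l))) (lhead (ldrop k (list_code m)))).
  { split; intros H k; [|now intros _].
    destruct (le_lt_dec (list_code l + list_code m) k) as [E|E].
    - left. split; apply ldrop_past_end; lia.
    - now apply H. }
  revert m; induction l as [|x l IH]; intros [|y m].
  - split; [constructor|]. left. simpl. now rewrite ldrop_nil.
  - split; intros H; [|inversion H].
    destruct (H 0) as [[_ E]|[[E _] _]]; [discriminate|now elim E].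
  - split; intros H; [|inversion H].
    destruct (H 0) as [[E _]|[[_ E] _]]; [discriminate|now elim E].
  - split.
    + intros H. constructor.
      * destruct (H 0) as [[E _]|[_ E]]; [discriminate|].
        simpl in E. now rewrite !ldrop_zero, !lhead_cons in E.
      * apply IH. intros k. specialize (H (S k)). simpl in H.
        now rewrite !ldrop_cons in H.
    + intros H. inversion H as [|? ? ? ? H0 H1]; subst. intros [|k]; simpl.
      * right. rewrite !ldrop_zero, !lhead_cons. auto.
      * rewrite !ldrop_cons. revert k. now apply IH.
Qed.

(** * Computable functions and decidable relations *)

(** One program has to serve all oracles, which is what makes the indices found
    below uniform. *)
Definition computable (f : nat -> nat) : Prop :=
  exists p, forall O x, eval O p x (f x).

Definition dec (P : (nat -> Prop) -> nat -> Prop) : Prop :=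
  exists p, forall O x, (P O x -> eval O p x 1) /\ (~ P O x -> eval O p x 0).

Create HintDb computability.

Lemma computable_ext f g : computable f -> (forall x, f x = g x) -> computable g.
Proof. intros [p Hp] H. exists p. intros O x. rewrite <- H. apply Hp. Qed.

Lemma computable_comp f g :
  computable f -> computable g -> computable (fun x => f (g x)).
Proof.
  intros [p Hp] [q Hq]. exists (PComp p q). intros O x. simpl. eauto.
Qed.

Definition PId : program := PPair PFst PSnd.

Lemma eval_PId O x : eval O PId x x.
Proof.
  exists (pi1 x), (pi2 x). repeat split. symmetry. apply pair_pi.
Qed.

Fixpoint PConst (k : nat) : program :=
  match k with
  | 0 => PZero
  | S k' => PComp PSucc (PConst k')
  end.

Lemma eval_PConst O k x : eval O (PConst k) x k.
Proof. induction k; simpl; eauto. Qed.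

Lemma computable_id : computable (fun x => x).
Proof. exists PId. intros. apply eval_PId. Qed.

Lemma computable_const k : computable (fun _ => k).
Proof. exists (PConst k). intros. apply eval_PConst. Qed.

Lemma computable_S f : computable f -> computable (fun x => S (f x)).
Proof. apply (computable_comp S). now exists PSucc. Qed.

Lemma computable_pi1 f : computable f -> computable (fun x => pi1 (f x)).
Proof. apply (computable_comp pi1). now exists PFst. Qed.

Lemma computable_pi2 f : computable f -> computable (fun x => pi2 (f x)).
Proof. apply (computable_comp pi2). now exists PSnd. Qed.

Lemma computable_pair f g :
  computable f -> computable g -> computable (fun x => <|f x, g x|>).
Proof.
  intros [p Hp] [q Hq]. exists (PPair p q). intros O x. simpl. eauto 6.
Qed.

Hint Resolve computable_const computable_id computable_S computable_pi1
  computable_pi2 computable_pair : computability.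
Hint Extern 1 (computable (fun x => ?f (@?g x))) =>
  match goal with H : computable f |- _ => apply (computable_comp f g H) end
  : computability.
Ltac computability := auto 60 with computability nocore.

Lemma computable_rec f (g : nat -> nat -> nat -> nat) h :
  computable f ->
  computable (fun q => g (pi1 q) (pi1 (pi2 q)) (pi2 (pi2 q))) ->
  computable h ->
  computable (fun x => nat_rect (fun _ => nat) (f x) (g x) (h x)).
Proof.
  intros [p Hp] [q Hq] [r Hr].
  exists (PComp (PRec p q) (PPair PId r)). intros O x.
  exists <|x, h x|>. split.
  - exists x, (h x). repeat split; auto. apply eval_PId.
  - simpl. fold (pi1 <|x, h x|>) (pi2 <|x, h x|>). rewrite pi1_pair, pi2_pair.
    induction (h x) as [|n IH]; simpl; [apply Hp|].
    eexists. split; [exact IH|].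
    specialize (Hq O <|x, n, nat_rect (fun _ => nat) (f x) (g x) n|>).
    now rewrite pi1_pair, pi2_pair, pi1_pair, pi2_pair in Hq.
Qed.

Lemma computable_pred f : computable f -> computable (fun x => pred (f x)).
Proof.
  intros Hf.
  apply (computable_ext
    (fun x => nat_rect (fun _ => nat) ((fun _ => 0) x) ((fun _ n _ => n) x) (f x))).
  - apply computable_rec; computability.
  - intros x. now destruct (f x).
Qed.

Lemma computable_add f g :
  computable f -> computable g -> computable (fun x => f x + g x).
Proof.
  intros Hf Hg.
  apply (computable_ext
    (fun x => nat_rect (fun _ => nat) (f x) ((fun _ _ r => S r) x) (g x))).
  - apply computable_rec; computability.
  - intros x. induction (g x) as [|n IH]; simpl in *; lia.
Qed.

Lemma computable_sub f g :
  computable f -> computable g -> computable (fun x => f x - g x).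
Proof.
  intros Hf Hg.
  apply (computable_ext
    (fun x => nat_rect (fun _ => nat) (f x) ((fun _ _ r => pred r) x) (g x))).
  - apply computable_rec; auto using computable_pred with computability.
  - intros x. induction (g x) as [|n IH]; simpl in *; lia.
Qed.

Lemma computable_mul f g :
  computable f -> computable g -> computable (fun x => f x * g x).
Proof.
  intros Hf Hg.
  apply (computable_ext
    (fun x => nat_rect (fun _ => nat) 0 ((fun x _ r => r + f x) x) (g x))).
  - apply computable_rec; auto using computable_add with computability.
  - intros x. induction (g x) as [|n IH]; simpl in *; lia.
Qed.

Lemma computable_pow2 f : computable f -> computable (fun x => 2 ^ f x).
Proof.
  intros Hf.
  apply (computable_ext
    (fun x => nat_rect (fun _ => nat) 1 ((fun _ _ r => r + r) x) (f x))).
  - apply computable_rec; auto using computable_add with computability.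
  - intros x. induction (f x) as [|n IH]; simpl in *; lia.
Qed.

Lemma computable_lhead f : computable f -> computable (fun x => lhead (f x)).
Proof. intros Hf. now apply computable_pi1, computable_pred. Qed.

Lemma computable_ltail f : computable f -> computable (fun x => ltail (f x)).
Proof. intros Hf. now apply computable_pi2, computable_pred. Qed.

Lemma computable_ldrop f g :
  computable f -> computable g -> computable (fun x => ldrop (f x) (g x)).
Proof.
  intros Hf Hg.
  apply (computable_ext
    (fun x => nat_rect (fun _ => nat) (g x) ((fun _ _ r => ltail r) x) (f x))).
  - apply computable_rec; auto using computable_ltail with computability.
  - reflexivity.
Qed.

Hint Resolve computable_pred computable_add computable_sub computable_mul
  computable_pow2 computable_lhead computable_ltail computable_ldrop
  : computability.

Lemma dec_ext P Q : dec P -> (forall O x, P O x <-> Q O x) -> dec Q.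
Proof. intros [p Hp] H. exists p. intros O x. rewrite <- H. apply Hp. Qed.

Lemma dec_zero f : computable f -> dec (fun _ x => f x = 0).
Proof.
  intros Hf. destruct (computable_sub (fun _ => 1) f) as [p Hp]; computability.
  exists p. intros O x. specialize (Hp O x). split; intros H.
  - now rewrite H in Hp.
  - replace 0 with (1 - f x) by lia. exact Hp.
Qed.

Lemma dec_not P : dec P -> dec (fun O x => ~ P O x).
Proof.
  intros [p Hp].
  destruct (computable_sub (fun _ => 1) (fun x => x)) as [q Hq]; computability.
  exists (PComp q p). intros O x. destruct (Hp O x) as [H1 H0]. split; intros H.
  - exists 0. split; [now apply H0 | apply (Hq O 0)].
  - exists 1. split; [apply H1; now apply NNPP | apply (Hq O 1)].
Qed.

Lemma mul_program : exists p, forall O u v, eval O p <|u, v|> (u * v).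
Proof.
  destruct (computable_mul pi1 pi2) as [p Hp]; computability.
  exists p. intros O u v. specialize (Hp O <|u, v|>).
  now rewrite pi1_pair, pi2_pair in Hp.
Qed.

Lemma dec_and P Q : dec P -> dec Q -> dec (fun O x => P O x /\ Q O x).
Proof.
  intros [p Hp] [q Hq]. destruct mul_program as [m Hm].
  exists (PComp m (PPair p q)). intros O x.
  destruct (Hp O x) as [P1 P0], (Hq O x) as [Q1 Q0].
  assert (G : forall u v, eval O p x u -> eval O q x v ->
            eval O (PComp m (PPair p q)) x (u * v)).
  { intros u v Hu Hv. exists <|u, v|>. split; [|apply Hm]. now exists u, v. }
  split.
  - intros [H1 H2]. exact (G 1 1 (P1 H1) (Q1 H2)).
  - intros H. destruct (classic (P O x)) as [H1|H1], (classic (Q O x)) as [H2|H2].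
    + tauto.
    + exact (G 1 0 (P1 H1) (Q0 H2)).
    + exact (G 0 1 (P0 H1) (Q1 H2)).
    + exact (G 0 0 (P0 H1) (Q0 H2)).
Qed.

Lemma dec_or P Q : dec P -> dec Q -> dec (fun O x => P O x \/ Q O x).
Proof.
  intros HP HQ.
  apply (dec_ext (fun O x => ~ (~ P O x /\ ~ Q O x))).
  - auto using dec_not, dec_and.
  - intros O x. split; [|tauto]. intros H. apply NNPP. tauto.
Qed.

Lemma dec_subst P f : dec P -> computable f -> dec (fun O x => P O (f x)).
Proof.
  intros [p Hp] [q Hq]. exists (PComp p q). intros O x.
  destruct (Hp O (f x)). split; intros; exists (f x); auto.
Qed.

Lemma dec_oracle f : computable f -> dec (fun O x => O (f x)).
Proof.
  apply (dec_subst (fun O x => O x)). exists PQuery. intros O x. simpl. tauto.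
Qed.

(** The recursion multiplies up the characteristic values of the instances. *)
Lemma dec_forall_lt P f :
  dec (fun O q => P O (pi1 q) (pi2 q)) -> computable f ->
  dec (fun O x => forall k, k < f x -> P O x k).
Proof.
  intros [p Hp] [r Hr]. destruct mul_program as [m Hm].
  (* On input <|x, n, v|>: multiply v by the value of p at <|x, n|>. *)
  pose (step := PComp m (PPair (PComp PSnd PSnd)
                               (PComp p (PPair PFst (PComp PFst PSnd))))).
  exists (PComp (PRec (PConst 1) step) (PPair PId r)). intros O x.
  assert (Run : forall y,
    rec_graph (eval O (PConst 1)) (eval O step) x (f x) y ->
    eval O (PComp (PRec (PConst 1) step) (PPair PId r)) x y).
  { intros y Hy. exists <|x, f x|>. split.
    - exists x, (f x). repeat split; auto. apply eval_PId.
    - simpl. fold (pi1 <|x, f x|>) (pi2 <|x, f x|>). now rewrite pi1_pair, pi2_pair. }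
  assert (Step : forall n v u, eval O p <|x, n|> u -> eval O step <|x, n, v|> (v * u)).
  { intros n v u Hu. exists <|v, u|>. split; [|apply Hm].
    exists v, u. repeat split.
    - exists <|n, v|>. split; symmetry; apply pi2_pair.
    - exists <|x, n|>. split; [|exact Hu]. exists x, n. repeat split.
      + symmetry; apply pi1_pair.
      + exists <|n, v|>. split; symmetry; [apply pi2_pair | apply pi1_pair]. }
  assert (Value : forall n,
     ((forall k, k < n -> P O x k) /\
        rec_graph (eval O (PConst 1)) (eval O step) x n 1) \/
     (~ (forall k, k < n -> P O x k) /\
        rec_graph (eval O (PConst 1)) (eval O step) x n 0)).
  { induction n as [|n IH].
    - left. split; [lia|]. apply eval_PConst.
    - pose proof (Hp O <|x, n|>) as [H1 H0]. rewrite pi1_pair, pi2_pair in H1, H0.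
      destruct IH as [[A B]|[A B]].
      + destruct (classic (P O x n)) as [C|C].
        * left. split.
          -- intros k Hk. destruct (Nat.eq_dec k n) as [->|]; [exact C|].
             apply A. lia.
          -- exists 1. split; [exact B|]. apply (Step n 1 1 (H1 C)).
        * right. split; [intros D; apply C, D; lia|].
          exists 1. split; [exact B|]. apply (Step n 1 0 (H0 C)).
      + right. split; [intros D; apply A; intros k Hk; apply D; lia|].
        exists 0. split; [exact B|].
        destruct (classic (P O x n)) as [C|C].
        * apply (Step n 0 1 (H1 C)).
        * apply (Step n 0 0 (H0 C)). }
  destruct (Value (f x)) as [[A B]|[A B]]; split; intros H; try tauto; now apply Run.
Qed.

Lemma dec_eq f g : computable f -> computable g -> dec (fun _ x => f x = g x).
Proof.
  intros Hf Hg. apply (dec_ext (fun _ x => (f x - g x) + (g x - f x) = 0)).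
  - apply dec_zero. computability.
  - intros _ x. lia.
Qed.

Lemma dec_lt f g : computable f -> computable g -> dec (fun _ x => f x < g x).
Proof.
  intros Hf Hg. apply (dec_ext (fun _ x => S (f x) - g x = 0)).
  - apply dec_zero. computability.
  - intros _ x. lia.
Qed.

Hint Resolve dec_eq dec_lt dec_not dec_and dec_or dec_oracle dec_forall_lt
  : computability.

(** * Semidecidable relations *)

Definition sigma1 (P : nat -> Prop) : Prop :=
  exists R : nat -> Prop, dec (fun _ => R) /\ forall x, P x <-> exists w, R <|x, w|>.

Lemma sigma1_ext P Q : sigma1 P -> (forall x, P x <-> Q x) -> sigma1 Q.
Proof.
  intros [R [HR H]] E. exists R. split; [exact HR|].
  intros x. now rewrite <- E.
Qed.

Lemma sigma1_dec P : dec (fun _ => P) -> sigma1 P.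
Proof.
  intros HP. exists (fun n => P (pi1 n)). split.
  - apply (dec_subst (fun _ => P)); computability.
  - intros x. split.
    + intros H. exists 0. now rewrite pi1_pair.
    + intros [w H]. now rewrite pi1_pair in H.
Qed.

Lemma sigma1_subst P f : sigma1 P -> computable f -> sigma1 (fun x => P (f x)).
Proof.
  intros [R [HR H]] Hf. exists (fun n => R <|f (pi1 n), pi2 n|>). split.
  - apply (dec_subst (fun _ => R)); computability.
  - intros x. rewrite H.
    split; intros [w Hw]; exists w; now unpair.
Qed.

Lemma sigma1_and P Q : sigma1 P -> sigma1 Q -> sigma1 (fun x => P x /\ Q x).
Proof.
  intros [R [HR EP]] [S [HS EQ]].
  exists (fun n => R <|pi1 n, pi1 (pi2 n)|> /\ S <|pi1 n, pi2 (pi2 n)|>). split.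
  - apply dec_and; [apply (dec_subst (fun _ => R)) | apply (dec_subst (fun _ => S))];
      computability.
  - intros x. rewrite EP, EQ. split.
    + intros [[v Hv] [w Hw]]. exists <|v, w|>.
      now rewrite !pi2_pair, !pi1_pair.
    + intros [w [Hv Hw]]. unpair. split; eexists; eassumption.
Qed.

Lemma sigma1_or P Q : sigma1 P -> sigma1 Q -> sigma1 (fun x => P x \/ Q x).
Proof.
  intros [R [HR EP]] [S [HS EQ]]. exists (fun n => R n \/ S n). split.
  - now apply dec_or.
  - intros x. rewrite EP, EQ. split.
    + intros [[w H]|[w H]]; exists w; tauto.
    + intros [w [H|H]]; [left|right]; now exists w.
Qed.

Lemma sigma1_ex (P : nat -> nat -> Prop) :
  sigma1 (fun q => P (pi1 q) (pi2 q)) -> sigma1 (fun x => exists y, P x y).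
Proof.
  intros [R [HR E]].
  exists (fun n => R <| <|pi1 n, pi1 (pi2 n)|>, pi2 (pi2 n)|>). split.
  - apply (dec_subst (fun _ => R)); computability.
  - intros x. split.
    + intros [y H]. specialize (E <|x, y|>). rewrite pi1_pair, pi2_pair in E.
      apply E in H as [w Hw]. exists <|y, w|>.
      now rewrite !pi1_pair, !pi2_pair, !pi1_pair.
    + intros [w Hw]. exists (pi1 (pi2 <|x, w|>)).
      specialize (E <|x, pi1 (pi2 <|x, w|>)|>). rewrite pi1_pair, pi2_pair in E.
      apply E. rewrite pi1_pair in Hw. now exists (pi2 (pi2 <|x, w|>)).
Qed.

(** Witnesses for the finitely many instances are collected in one list. *)
Lemma sigma1_forall_lt (P : nat -> nat -> Prop) f :
  sigma1 (fun q => P (pi1 q) (pi2 q)) -> computable f ->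
  sigma1 (fun x => forall k, k < f x -> P x k).
Proof.
  intros [R [HR E]] Hf.
  assert (E' : forall x k, P x k <-> exists w, R <| <|x, k|>, w|>).
  { intros x k. specialize (E <|x, k|>). now rewrite pi1_pair, pi2_pair in E. }
  exists (fun n => forall k, k < f (pi1 n) ->
            R <| <|pi1 n, k|>, lhead (ldrop k (pi2 n))|>). split.
  - apply (dec_forall_lt (fun _ n k => R <| <|pi1 n, k|>, lhead (ldrop k (pi2 n))|>)).
    + apply (dec_subst (fun _ => R)); computability.
    + computability.
  - intros x. split.
    + intros H.
      assert (L : exists l, length l = f x /\
                forall k, k < f x -> R <| <|x, k|>, nth k l (lhead 0)|>).
      { induction (f x) as [|n IH]; [exists []; split; [reflexivity|lia]|].
        destruct IH as [l [Hl Hk]]; [auto|].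
        destruct (proj1 (E' x n)) as [w Hw]; [auto|].
        exists (l ++ [w]). rewrite length_app. simpl. split; [lia|].
        intros k Hk'. destruct (Nat.eq_dec k n) as [->|].
        - rewrite app_nth2 by lia. now rewrite Hl, Nat.sub_diag.
        - rewrite app_nth1 by lia. apply Hk. lia. }
      destruct L as [l [_ Hl]]. exists (list_code l).
      rewrite pi1_pair, pi2_pair. intros k Hk. rewrite lhead_ldrop_nth. auto.
    + intros [w Hw] k Hk. rewrite pi1_pair, pi2_pair in Hw.
      apply E'. eexists. now apply Hw.
Qed.

Lemma sigma1_eq f g : computable f -> computable g -> sigma1 (fun x => f x = g x).
Proof. intros. apply sigma1_dec. computability. Qed.

Lemma sigma1_neq f g : computable f -> computable g -> sigma1 (fun x => f x <> g x).
Proof. intros. apply sigma1_dec. computability. Qed.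

Lemma sigma1_lt f g : computable f -> computable g -> sigma1 (fun x => f x < g x).
Proof. intros. apply sigma1_dec. computability. Qed.

Hint Resolve sigma1_eq sigma1_neq sigma1_lt sigma1_and sigma1_or sigma1_ex
  sigma1_forall_lt : computability.

Lemma sigma1_mem f g : computable f -> computable g -> sigma1 (fun x => mem (f x) (g x)).
Proof. intros. unfold mem. computability. Qed.

Lemma sigma1_zip_mem f g h i :
  computable f -> computable g -> computable h -> computable i ->
  sigma1 (fun x => zip_mem (f x) (g x) (h x) (i x)).
Proof. intros. unfold zip_mem. computability. Qed.

Lemma sigma1_all_suffixes (Q : nat -> nat -> nat -> Prop) f :
  sigma1 (fun q => Q (pi1 q) (pi1 (pi2 q)) (pi2 (pi2 q))) -> computable f ->
  sigma1 (fun x => all_suffixes (Q x) (f x)).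
Proof.
  intros HQ Hf. unfold all_suffixes.
  apply sigma1_forall_lt; [|exact Hf]. apply sigma1_or; [computability|].
  pose (r := fun q => <|pi1 q, lhead (ldrop (pi2 q) (f (pi1 q))),
                     ltail (ldrop (pi2 q) (f (pi1 q)))|>).
  apply (sigma1_ext (fun q => Q (pi1 (r q)) (pi1 (pi2 (r q))) (pi2 (pi2 (r q))))).
  - apply (sigma1_subst _ r HQ). unfold r. computability.
  - intros q. unfold r. now rewrite pi1_pair, pi2_pair, pi1_pair, pi2_pair.
Qed.

Lemma sigma1_all (Q : nat -> nat -> Prop) f :
  sigma1 (fun q => Q (pi1 q) (pi2 q)) -> computable f ->
  sigma1 (fun x => all (Q x) (f x)).
Proof.
  intros HQ Hf. apply (sigma1_all_suffixes (fun x y _ => Q x y)); [|exact Hf].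
  pose (r := fun q => <|pi1 q, pi1 (pi2 q)|>).
  apply (sigma1_ext (fun q => Q (pi1 (r q)) (pi2 (r q)))).
  - apply (sigma1_subst _ r HQ). unfold r. computability.
  - intros q. unfold r. now rewrite pi1_pair, pi2_pair.
Qed.

Lemma sigma1_all2 (Q : nat -> nat -> nat -> Prop) f g :
  sigma1 (fun q => Q (pi1 q) (pi1 (pi2 q)) (pi2 (pi2 q))) ->
  computable f -> computable g ->
  sigma1 (fun x => all2 (Q x) (f x) (g x)).
Proof.
  intros HQ Hf Hg. unfold all2.
  apply sigma1_forall_lt; [|computability].
  apply sigma1_or; [computability|]. apply sigma1_and; [computability|].
  pose (r := fun q => <|pi1 q, lhead (ldrop (pi2 q) (f (pi1 q))),
                     lhead (ldrop (pi2 q) (g (pi1 q)))|>).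
  apply (sigma1_ext (fun q => Q (pi1 (r q)) (pi1 (pi2 (r q))) (pi2 (pi2 (r q))))).
  - apply (sigma1_subst _ r HQ). unfold r. computability.
  - intros q. unfold r. now rewrite pi1_pair, pi2_pair, pi1_pair, pi2_pair.
Qed.

Hint Resolve sigma1_mem sigma1_zip_mem sigma1_all sigma1_all2 : computability.
(** * Inductive definitions *)

(** The condition under which the least fixed point of a rule is reached by
    finite derivations.  Being preserved by the positive connectives and by
    bounded quantification, it can be read off from the shape of a rule. *)
Definition continuous (F : (nat -> Prop) -> Prop) : Prop :=
  (forall X Y : nat -> Prop, (forall y, X y -> Y y) -> F X -> F Y) /\
  (forall X, F X -> exists t, Forall X t /\ F (fun y => In y t)).

Lemma continuous_const P : continuous (fun _ => P).
Proof. split; [auto|]. intros X H. now exists []. Qed.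

Lemma continuous_elem n : continuous (fun X => X n).
Proof.
  split; [auto|]. intros X H. exists [n]. split; [now constructor|now left].
Qed.

Lemma continuous_and F G :
  continuous F -> continuous G -> continuous (fun X => F X /\ G X).
Proof.
  intros [MF CF] [MG CG]. split.
  - intros X Y XY [HF HG]. eauto.
  - intros X [HF HG].
    destruct (CF X HF) as [t [Ht Ft]], (CG X HG) as [s [Hs Gs]].
    exists (t ++ s). rewrite Forall_app. split; [tauto|]. split.
    + apply (MF (fun y => In y t)); [|exact Ft]. auto using in_or_app.
    + apply (MG (fun y => In y s)); [|exact Gs]. auto using in_or_app.
Qed.

Lemma continuous_or F G :
  continuous F -> continuous G -> continuous (fun X => F X \/ G X).
Proof.
  intros [MF CF] [MG CG]. split.
  - intros X Y XY [HF|HG]; eauto.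
  - intros X [HF|HG].
    + destruct (CF X HF) as [t [Ht Ft]]. eauto.
    + destruct (CG X HG) as [t [Ht Ft]]. eauto.
Qed.

Lemma continuous_ex (F : nat -> (nat -> Prop) -> Prop) :
  (forall n, continuous (F n)) -> continuous (fun X => exists n, F n X).
Proof.
  intros H. split.
  - intros X Y XY [n Hn]. exists n. now apply (proj1 (H n) X).
  - intros X [n Hn]. destruct (proj2 (H n) X Hn) as [t [Ht Ft]]. eauto.
Qed.

Lemma continuous_forall_lt (F : nat -> (nat -> Prop) -> Prop) n :
  (forall m, continuous (F m)) -> continuous (fun X => forall m, m < n -> F m X).
Proof.
  intros H. split.
  - intros X Y XY HX m Hm. apply (proj1 (H m) X); auto.
  - intros X HX. induction n as [|n IH]; [exists []; split; [constructor|lia]|].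
    destruct IH as [t [Ht Ft]]; [auto|].
    destruct (proj2 (H n) X) as [s [Hs Fs]]; [auto|].
    exists (t ++ s). rewrite Forall_app. split; [tauto|].
    intros m Hm. destruct (Nat.eq_dec m n) as [->|].
    + apply (proj1 (H n) (fun y => In y s)); auto using in_or_app.
    + apply (proj1 (H m) (fun y => In y t)); [auto using in_or_app|].
      apply Ft. lia.
Qed.

Hint Resolve continuous_const continuous_elem continuous_and continuous_or
  continuous_ex continuous_forall_lt : computability.

(** The least fixed point of [J].  Taking the premises from a finite list keeps
    the definition strictly positive for arbitrary [J], and loses nothing for
    continuous rules ([derivable_unfold]). *)
Inductive derivable (J : (nat -> Prop) -> nat -> Prop) (h : nat) : Prop :=
| derive t : (forall y, In y t -> derivable J y) -> J (fun y => In y t) h ->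
    derivable J h.

Lemma derivable_unfold J h :
  (forall h, continuous (fun X => J X h)) ->
  derivable J h <-> J (derivable J) h.
Proof.
  intros HJ. split.
  - intros [t Ht H]. now apply (proj1 (HJ h) (fun y => In y t)).
  - intros H. destruct (proj2 (HJ h) _ H) as [t [Ht H']].
    apply (derive _ _ t); [|exact H']. now apply Forall_forall.
Qed.

Lemma derivable_least J (P : nat -> Prop) :
  (forall h, continuous (fun X => J X h)) ->
  (forall h, J P h -> P h) -> forall h, derivable J h -> P h.
Proof.
  intros HJ HP h H. induction H as [h t _ IH H].
  apply HP. now apply (proj1 (HJ h) (fun y => In y t)).
Qed.

(** Listing a derivation backwards makes its correctness a condition on the
    suffixes of the list, and lets certificates be merged by concatenation. *)
Fixpoint supported (J : (nat -> Prop) -> nat -> Prop) (w : list nat) : Prop :=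
  match w with
  | [] => True
  | h :: t => J (fun y => In y t) h /\ supported J t
  end.

Lemma supported_app J w w' :
  (forall h, continuous (fun X => J X h)) ->
  supported J w -> supported J w' -> supported J (w ++ w').
Proof.
  intros HJ. induction w as [|h w IH]; simpl; [auto|]. intros [H0 H] H'.
  split; [|auto]. apply (proj1 (HJ h) (fun y => In y w)); auto using in_or_app.
Qed.

Lemma derivable_iff_supported J h :
  (forall h, continuous (fun X => J X h)) ->
  derivable J h <-> exists w, supported J w /\ In h w.
Proof.
  intros HJ. split.
  - intros H. induction H as [h t _ IH H].
    assert (W : exists w, supported J w /\ incl t w).
    { clear H. induction t as [|y t IHt]; [exists []; split; [exact I|easy]|].
      destruct IHt as [w [Hw Ht]]; [intros z Hz; apply IH; now right|].
      destruct (IH y) as [w' [Hw' Hy]]; [now left|].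
      exists (w' ++ w). split; [now apply supported_app|].
      intros z [->|Hz]; apply in_or_app; auto. }
    destruct W as [w [Hw Ht]]. exists (h :: w). split; [|now left].
    split; [|exact Hw]. now apply (proj1 (HJ h) (fun y => In y t)).
  - intros [w [Hw Hh]]. revert h Hh.
    induction w as [|h w IH]; [easy|]. destruct Hw as [H0 H].
    intros y [<-|Hy]; [|now apply IH].
    apply (derive _ _ w); [now apply IH | exact H0].
Qed.

Lemma supported_code J w :
  (forall h, continuous (fun X => J X h)) ->
  supported J w <->
  all_suffixes (fun h t => J (fun y => mem y t) h) (list_code w).
Proof.
  intros HJ. induction w as [|h w IH]; simpl.
  - split; [intros _; apply all_suffixes_nil | auto].
  - rewrite all_suffixes_cons, <- IH.
    enough (J (fun y => In y w) h <-> J (fun y => mem y (list_code w)) h) by tauto.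
    split; apply (proj1 (HJ h)); intros y; apply mem_code.
Qed.

(** The existential quantifier ranges over certificates, and their correctness
    is a bounded quantification over the rule with its premises looked up in a
    list. *)
Lemma sigma1_derivable (J : nat -> (nat -> Prop) -> nat -> Prop) f g :
  (forall z h, continuous (fun X => J z X h)) ->
  sigma1 (fun q => J (pi1 q) (fun y => mem y (pi2 (pi2 q))) (pi1 (pi2 q))) ->
  computable f -> computable g ->
  sigma1 (fun x => derivable (J (f x)) (g x)).
Proof.
  intros HJ HS Hf Hg.
  apply (sigma1_ext (fun x => exists w,
    all_suffixes (fun h t => J (f x) (fun y => mem y t) h) w /\ mem (g x) w)).
  - apply sigma1_ex, sigma1_and; [|computability].
    apply (sigma1_all_suffixes
      (fun q h t => J (f (pi1 q)) (fun y => mem y t) h)); [|computability].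
    pose (r := fun q => <|f (pi1 (pi1 q)), pi2 q|>).
    apply (sigma1_ext (fun q => J (pi1 (r q)) (fun y => mem y (pi2 (pi2 (r q))))
                                  (pi1 (pi2 (r q))))).
    + apply (sigma1_subst _ r HS). unfold r. computability.
    + intros q. unfold r. now rewrite pi1_pair, pi2_pair.
  - intros x. rewrite derivable_iff_supported by auto. split.
    + intros [w [Hw Hx]]. destruct (list_code_surj w) as [l ->].
      exists l. now rewrite supported_code, <- mem_code.
    + intros [l [Hl Hx]]. exists (list_code l).
      now rewrite <- supported_code, mem_code.
Qed.

(** * Evaluation of coded programs *)

Lemma rec_graph_functional F G a n y y' :
  (forall x y y', F x y -> F x y' -> y = y') ->
  (forall x y y', G x y -> G x y' -> y = y') ->
  rec_graph F G a n y -> rec_graph F G a n y' -> y = y'.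
Proof.
  intros HF HG. revert y y'. induction n as [|n IH]; simpl; [apply HF|].
  intros y y' [r [Hr H]] [r' [Hr' H']]. rewrite (IH r r') in H by auto. eauto.
Qed.

Lemma eval_functional O p x y y' : eval O p x y -> eval O p x y' -> y = y'.
Proof.
  revert x y y'; induction p; simpl; intros x y y'; try congruence.
  - intros [[]|[]] [[]|[]]; congruence || tauto.
  - intros (u & v & Hu & Hv & ->) (u' & v' & Hu' & Hv' & ->). f_equal; eauto.
  - intros (z & Hz & H) (z' & Hz' & H'). rewrite (IHp2 x z z') in H by auto. eauto.
  - now apply rec_graph_functional.
  - intros [H0 H] [H0' H']. destruct (lt_eq_lt_dec y y') as [[L|E]|L]; [|exact E|].
    + destruct (H' y L) as [k Hk]. now specialize (IHp _ _ _ H0 Hk).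
    + destruct (H y' L) as [k Hk]. now specialize (IHp _ _ _ H0' Hk).
Qed.

(** Kleene's schemes read as rules for judgements [<|p, x, y|>] on codes, with
    the oracle answering no throughout. *)
Definition eval_rule (X : nat -> Prop) (j : nat) : Prop :=
  exists p x y, j = <|p, x, y|> /\
  ((p = <|0, 0|> /\ y = 0) \/
   (p = <|1, 0|> /\ y = S x) \/
   (p = <|2, 0|> /\ y = pi1 x) \/
   (p = <|3, 0|> /\ y = pi2 x) \/
   (p = <|4, 0|> /\ y = 0) \/
   (exists q r, p = <|5, q, r|> /\ exists u v,
      X <|q, x, u|> /\ X <|r, x, v|> /\ y = <|u, v|>) \/
   (exists q r, p = <|6, q, r|> /\ exists z, X <|r, x, z|> /\ X <|q, z, y|>) \/
   (exists q r, p = <|7, q, r|> /\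
      ((pi2 x = 0 /\ X <|q, pi1 x, y|>) \/
       exists n v, pi2 x = S n /\
         X <|p, <|pi1 x, n|>, v|> /\ X <|r, <|pi1 x, n, v|>, y|>)) \/
   (exists q, p = <|8, q|> /\ X <|q, <|x, y|>, 0|> /\
      forall m, m < y -> exists k, X <|q, <|x, m|>, S k|>)).

Definition yields (e x y : nat) : Prop := derivable eval_rule <|e, x, y|>.

Lemma eval_rule_continuous h : continuous (fun X => eval_rule X h).
Proof. unfold eval_rule. computability. Qed.

Lemma sigma1_yields f g h :
  computable f -> computable g -> computable h ->
  sigma1 (fun x => yields (f x) (g x) (h x)).
Proof.
  intros. unfold yields.
  apply (sigma1_derivable (fun _ => eval_rule) (fun _ => 0)).
  - intros _. apply eval_rule_continuous.
  - unfold eval_rule. computability.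
  - computability.
  - computability.
Qed.
Hint Resolve sigma1_yields : computability.

Lemma yields_unfold p x y :
  yields p x y <-> eval_rule (derivable eval_rule) <|p, x, y|>.
Proof. apply derivable_unfold, eval_rule_continuous. Qed.

Ltac tags :=
  repeat match goal with
  | H : exists _, _ |- _ => destruct H
  | H : _ /\ _ |- _ => destruct H
  | H : _ \/ _ |- _ => destruct H
  end; pairs; try discriminate.

Lemma yields_rec q r a n y :
  (forall x y, yields (program_code q) x y <-> eval no_oracle q x y) ->
  (forall x y, yields (program_code r) x y <-> eval no_oracle r x y) ->
  yields (program_code (PRec q r)) <|a, n|> y <->
  rec_graph (eval no_oracle q) (eval no_oracle r) a n y.
Proof.
  intros Hq Hr. revert y; induction n as [|n IH]; intros y; simpl.
  - rewrite <- Hq. rewrite yields_unfold. split.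
    + intros H. unfold eval_rule in H. tags; unpair;
      solve [easy | assumption].
    + intros H. do 3 eexists. split; [reflexivity|]. do 7 right. left.
      do 2 eexists. split; [reflexivity|]. left. now rewrite pi1_pair, pi2_pair.
  - rewrite yields_unfold. split.
    + intros H. unfold eval_rule in H. tags; unpair.
      * easy.
      * match goal with H : S _ = S _ |- _ => injection H as <- end.
        eexists. split; [apply IH | apply Hr]; eassumption.
    + intros [v [Hv H]]. apply IH in Hv. apply Hr in H.
      do 3 eexists. split; [reflexivity|]. do 7 right. left.
      do 2 eexists. split; [reflexivity|]. right. exists n, v.
      now rewrite pi1_pair, pi2_pair.
Qed.

(** The universal machine.  Only genuine codes are considered, so the rule may
    be permissive about numbers that code no program. *)
Lemma yields_eval p x y : yields (program_code p) x y <-> eval no_oracle p x y.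
Proof.
  revert x y; induction p; intros x y;
    [rewrite yields_unfold; simpl .. | | ].
  - split; [intros H; unfold eval_rule in H; now tags|].
    intros ->. do 3 eexists. split; [reflexivity|]. now left.
  - split; [intros H; unfold eval_rule in H; now tags|].
    intros ->. do 3 eexists. split; [reflexivity|]. right. now left.
  - split; [intros H; unfold eval_rule in H; now tags|].
    intros ->. do 3 eexists. split; [reflexivity|]. do 2 right. now left.
  - split; [intros H; unfold eval_rule in H; now tags|].
    intros ->. do 3 eexists. split; [reflexivity|]. do 3 right. now left.
  - split; [intros H; unfold eval_rule in H; tags; now right|].
    intros [[[]]|[_ ->]]. do 3 eexists. split; [reflexivity|]. do 4 right. now left.
  - split.
    + intros H; unfold eval_rule in H; tags. do 2 eexists.
      split; [apply IHp1; eassumption|].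
      split; [apply IHp2; eassumption|reflexivity].
    + intros (u & v & Hu & Hv & ->). apply IHp1 in Hu. apply IHp2 in Hv.
      do 3 eexists. split; [reflexivity|]. do 5 right. left.
      do 2 eexists. split; [reflexivity|]. eauto.
  - split.
    + intros H; unfold eval_rule in H; tags. eexists.
      split; [apply IHp2 | apply IHp1]; eassumption.
    + intros (z & Hz & H). apply IHp1 in H. apply IHp2 in Hz.
      do 3 eexists. split; [reflexivity|]. do 6 right. left.
      do 2 eexists. split; [reflexivity|]. eauto.
  - rewrite <- (pair_pi x) at 1. now apply yields_rec.
  - rewrite yields_unfold. simpl. split.
    + intros H; unfold eval_rule in H; tags. split; [now apply IHp|].
      intros m Hm.
      match goal with H : forall m, _ |- _ => destruct (H m Hm) as [k Hk] end.
      exists k. now apply IHp.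
    + intros [H0 H]. do 3 eexists. split; [reflexivity|]. do 8 right.
      eexists. split; [reflexivity|]. split; [now apply IHp|].
      intros m Hm. destruct (H m Hm) as [k Hk]. exists k. now apply IHp.
Qed.

Lemma yields_run e x y x0 y0 : run e x0 y0 -> yields e x y <-> run e x y.
Proof.
  intros [p [<- _]]. rewrite yields_eval. split.
  - intros H. now exists p.
  - intros [p' [E H]]. apply yields_eval. rewrite <- E. now apply yields_eval.
Qed.

Lemma run_functional e x y y' : run e x y -> run e x y' -> y = y'.
Proof.
  intros H H'. destruct H as [p [<- H]].
  rewrite <- (yields_run _ x y' x y) in H' by now exists p.
  apply yields_eval in H'. exact (eval_functional _ _ _ _ _ H H').
Qed.

(** Since a decision procedure always halts, with a single output, both answers
    are semidecidable conditions that exclude each other. *)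
Lemma decides_yields e P :
  decides no_oracle e P ->
  forall n, (yields e n 1 <-> P n) /\ (yields e n 0 <-> ~ P n).
Proof.
  intros D n. destruct (D n) as [H1 H0].
  change (P n -> run e n 1) in H1. change (~ P n -> run e n 0) in H0.
  assert (E : forall y, yields e n y <-> run e n y).
  { intros y. destruct (classic (P n)) as [H|H].
    - exact (yields_run _ _ _ _ _ (H1 H)).
    - exact (yields_run _ _ _ _ _ (H0 H)). }
  rewrite !E. split; split; auto.
  - intros H. apply NNPP. intros N. specialize (H0 N).
    now pose proof (run_functional _ _ _ _ H H0).
  - intros H N. specialize (H1 N). now pose proof (run_functional _ _ _ _ H H1).
Qed.

(** * Uniform indices *)

(** The s-m-n theorem: a parameter is hard-wired by prefixing the program with
    a constant, and the code of the resulting program is computed from it. *)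
Lemma hardwire P :
  dec P ->
  exists s, computable s /\ forall O k, decides O (s k) (fun n => P O <|k, n|>).
Proof.
  intros [p Hp].
  exists (fun k => program_code (PComp p (PPair (PConst k) PId))). split.
  - assert (C : computable (fun k => program_code (PConst k))).
    { apply (computable_ext (fun k => nat_rect (fun _ => nat) <|0, 0|>
        ((fun _ _ r => <|6, <|1, 0|>, r|>) k) k)).
      - apply computable_rec; computability.
      - induction x as [|x IH]; simpl in *; [reflexivity|now rewrite IH]. }
    cbn [program_code]. fold (program_code PId). computability.
  - intros O k n.
    assert (G : forall y, eval O p <|k, n|> y ->
        run_oracle O (program_code (PComp p (PPair (PConst k) PId))) n y).
    { intros y Hy. eexists. split; [reflexivity|]. exists <|k, n|>.
      split; [|exact Hy]. exists k, n.
      repeat split; [apply eval_PConst | apply eval_PId]. }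
    destruct (Hp O <|k, n|>). split; auto.
Qed.

Lemma computable2_of s : computable s -> computable2 (fun c e => s <|c, e|>).
Proof.
  intros [p Hp]. exists (program_code p). intros c e. exists p. auto.
Qed.

(** The witness for the semidecidable [A] and the list [l] share the one
    existential quantifier; asking the oracle about the entries of [l] is a
    bounded search. *)
Lemma sigma_index_1 (A : nat -> nat -> Prop) :
  sigma1 (fun q => A (pi1 q) (pi2 q)) ->
  exists s, computable s /\ forall O k S,
    (forall x, S x <-> exists l, A <|k, x|> l /\ all O l) ->
    sigma_index O 1 (s k) S.
Proof.
  intros [R [HR E]].
  assert (E' : forall x l, A x l <-> exists w, R <| <|x, l|>, w|>).
  { intros x l. specialize (E <|x, l|>). now rewrite pi1_pair, pi2_pair in E. }
  pose (Q := fun (O : nat -> Prop) k x l w =>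
    R <| <| <|k, x|>, l|>, w|> /\ all O l).
  destruct (hardwire (fun O n => Q O (pi1 n) (pi1 (pi2 n)) (pi1 (pi2 (pi2 n)))
                                   (pi2 (pi2 (pi2 n))))) as [s [Hs D]].
  { unfold Q, all, all_suffixes. apply dec_and; [|computability].
    apply (dec_subst (fun _ => R)); computability. }
  exists s. split; [exact Hs|]. intros O k S H.
  exists (fun n => Q O k (pi1 n) (pi1 (pi2 n)) (pi2 (pi2 n))). split.
  - intros n. specialize (D O k n). cbv beta in D.
    now rewrite pi1_pair, pi2_pair in D.
  - intros x. rewrite H. simpl. unfold Q. split.
    + intros [l [Hl HO]]. apply E' in Hl as [w Hw]. exists <|l, w|>.
      now rewrite !pi2_pair, !pi1_pair.
    + intros [y [Hw HO]]. rewrite pi1_pair in Hw.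
      eexists. split; [|exact HO]. apply E'. eauto.
Qed.

(** The witness for [P] joins the outer quantifier, and the universal one ranges
    over the would-be witnesses for [N]. *)
Lemma sigma_index_2 (P N : nat -> nat -> Prop) :
  sigma1 (fun q => P (pi1 q) (pi2 q)) -> sigma1 (fun q => N (pi1 q) (pi2 q)) ->
  exists s, computable s /\ forall k S,
    (forall x, S x <-> exists y, P <|k, x|> y /\ ~ N <|k, x|> y) ->
    sigma_index no_oracle 2 (s k) S.
Proof.
  intros [R [HR EP]] [T [HT EN]].
  assert (EP' : forall x y, P x y <-> exists w, R <| <|x, y|>, w|>).
  { intros x y. specialize (EP <|x, y|>). now rewrite pi1_pair, pi2_pair in EP. }
  assert (EN' : forall x y, N x y <-> exists z, T <| <|x, y|>, z|>).
  { intros x y. specialize (EN <|x, y|>). now rewrite pi1_pair, pi2_pair in EN. }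
  pose (Q := fun k x y w z =>
    R <| <| <|k, x|>, y|>, w|> /\ ~ T <| <| <|k, x|>, y|>, z|>).
  destruct (hardwire (fun _ n => Q (pi1 n) (pi1 (pi1 (pi2 n)))
      (pi1 (pi2 (pi1 (pi2 n)))) (pi2 (pi2 (pi1 (pi2 n)))) (pi2 (pi2 n))))
    as [s [Hs D]].
  { unfold Q. apply dec_and; [|apply dec_not].
    - apply (dec_subst (fun _ => R)); computability.
    - apply (dec_subst (fun _ => T)); computability. }
  exists s. split; [exact Hs|]. intros k S H.
  exists (fun n => Q k (pi1 (pi1 n)) (pi1 (pi2 (pi1 n))) (pi2 (pi2 (pi1 n))) (pi2 n)).
  split.
  - intros n. specialize (D no_oracle k n). cbv beta in D.
    now rewrite pi1_pair, pi2_pair in D.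
  - intros x. rewrite H. simpl. split.
    + intros [y [HP HN]]. apply EP' in HP as [w Hw]. exists <|y, w|>. intros z.
      unfold Q. unpair.
      split; [exact Hw|]. intros Hz. apply HN, EN'. eauto.
    + intros [v Hv]. exists (pi1 v). unfold Q in Hv. split.
      * destruct (Hv 0) as [Hw _].
        rewrite !pi1_pair, !pi2_pair in Hw. apply EP'. eauto.
      * intros HN. apply EN' in HN as [z Hz]. destruct (Hv z) as [_ Hz'].
        now rewrite !pi1_pair, !pi2_pair in Hz'.
Qed.
(** * Satisfaction of quantifier-free formulas *)

Definition sort_code (c a j : nat) : Prop :=
  exists d, yields c 1 d /\ yields (pi1 (pi2 d)) <|a, j|> 1.

Definition rel_code (c i b v : nat) : Prop :=
  exists d, yields c 1 d /\ yields (pi2 (pi2 d)) <|b, i|> v.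

Lemma structure_yields c L M :
  CompStr c L M ->
  exists d, (forall d', yields c 1 d' <-> d' = d) /\ structure_code L d M.
Proof.
  intros (l & d & _ & H & _ & Hd). exists d. split; [|exact Hd].
  intros d'. rewrite (yields_run _ _ _ _ _ H). split.
  - intros H'. exact (run_functional _ _ _ _ H' H).
  - now intros ->.
Qed.

Lemma sort_code_spec c L M a j :
  CompStr c L M -> sort_code c a j <-> has_sort M a j.
Proof.
  intros H. destruct (structure_yields _ _ _ H) as (d & Hd & _ & u & s & r & E & _ & Hs & _).
  transitivity (yields s <|a, j|> 1).
  - unfold sort_code. split.
    + intros (d' & Hd' & H'). apply Hd in Hd'. subst. now unpair.
    + intros H'. exists d. rewrite Hd, E. now unpair.
  - rewrite (proj1 (decides_yields _ _ Hs _)). split.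
    + intros (a' & j' & E' & H'). now pairs.
    + eauto.
Qed.

Lemma rel_code_spec c L M i b :
  CompStr c L M ->
  (rel_code c i (list_code b) 1 <-> rel M i b) /\
  (rel_code c i (list_code b) 0 <-> ~ rel M i b).
Proof.
  intros H. destruct (structure_yields _ _ _ H) as (d & Hd & _ & u & s & r & E & _ & _ & Hr).
  assert (G : forall v, rel_code c i (list_code b) v <-> yields r <|list_code b, i|> v).
  { unfold rel_code. split.
    + intros (d' & Hd' & H'). apply Hd in Hd'. subst. now unpair.
    + intros H'. exists d. rewrite Hd, E. now unpair. }
  rewrite !G, (proj1 (decides_yields _ _ Hr _)), (proj2 (decides_yields _ _ Hr _)).
  enough ((exists b' i', <|list_code b, i|> = <|list_code b', i'|> /\ rel M i' b')
            <-> rel M i b) by tauto.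
  split; [|eauto].
  intros (b' & i' & E' & H'). pairs.
  match goal with E : list_code _ = _ |- _ => apply list_code_inj in E end.
  now subst.
Qed.

(** An assignment is coded by pairing a list of variables with a list of values,
    once for the [x]-variables and once for the [y]-variables. *)
Definition value (z v n : nat) : Prop :=
  zip_mem v n (pi1 (pi1 z)) (pi2 (pi1 z)) \/ zip_mem v n (pi1 (pi2 z)) (pi2 (pi2 z)).

Lemma var_eqb_spec v w : var_eqb v w = true <-> v = w.
Proof.
  destruct v, w. unfold var_eqb. simpl.
  rewrite Bool.andb_true_iff, !Nat.eqb_eq. split.
  - now intros [-> ->].
  - now intros [= -> ->].
Qed.

Lemma var_code_inj v w : var_code v = var_code w -> v = w.
Proof. destruct v, w. unfold var_code. simpl. intros H. now pairs. Qed.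

Lemma in_combine_assignment vs w v n :
  NoDup vs -> length vs = length w ->
  In (v, n) (combine vs w) <-> In v vs /\ n = assignment vs w v.
Proof.
  revert w; induction vs as [|v0 vs IH]; intros [|n0 w] Hnd Hl;
    try discriminate; simpl; [tauto|].
  inversion Hnd as [|? ? Hn Hnd']; subst. injection Hl as Hl.
  rewrite (IH w) by auto. unfold update.
  destruct (var_eqb v v0) eqn:E.
  - apply var_eqb_spec in E as ->. split; [|intros [_ ->]; now left].
    intros [E|[H _]]; [|contradiction]. injection E as ->. auto.
  - assert (v0 <> v) by (intros ->; now rewrite (proj2 (var_eqb_spec v v)) in E).
    split; [|tauto]. intros [E'|]; [now injection E'|tauto].
Qed.

Lemma combine_app {A B} (l l' : list A) (m m' : list B) :
  length l = length m -> combine (l ++ l') (m ++ m') = combine l m ++ combine l' m'.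
Proof.
  revert m; induction l as [|x l IH]; intros [|y m] H; try discriminate; simpl;
    [reflexivity|]. f_equal. apply IH. now injection H.
Qed.

Lemma in_combine_var_code (v : var) (n : nat) vs w :
  In (var_code v, n) (combine (map var_code vs) w) <-> In (v, n) (combine vs w).
Proof.
  revert w; induction vs as [|v0 vs IH]; intros [|n0 w]; simpl; try tauto.
  rewrite IH.
  enough ((var_code v0, n0) = (var_code v, n) <-> (v0, n0) = (v, n)) by tauto.
  split; intros E; injection E as E ->; [apply var_code_inj in E|]; now subst.
Qed.

Lemma value_assignment xs ys a b v n :
  NoDup (xs ++ ys) -> length xs = length a -> length ys = length b ->
  value <| <|vars_code xs, list_code a|>, vars_code ys, list_code b|> (var_code v) n
  <-> In v (xs ++ ys) /\ n = assignment (xs ++ ys) (a ++ b) v.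
Proof.
  intros Hnd Ha Hb. rewrite <- in_combine_assignment; [|exact Hnd|].
  2: now rewrite !length_app, Ha, Hb.
  rewrite combine_app, in_app_iff by exact Ha.
  unfold value, vars_code. unpair.
  now rewrite !zip_mem_code, !in_combine_var_code.
Qed.

Lemma all2_value z s vs b :
  (forall v n, In v vs -> value z (var_code v) n <-> n = s v) ->
  all2 (value z) (vars_code vs) b <-> b = list_code (map s vs).
Proof.
  destruct (list_code_surj b) as [l ->]. unfold vars_code. rewrite all2_code.
  intros H. transitivity (l = map s vs).
  - revert l; induction vs as [|v vs IH]; intros l; simpl.
    + split; [intros H'; now inversion H' | intros ->; constructor].
    + split.
      * intros H'. inversion H' as [|? n ? l' Hn Hl]; subst.
        apply H in Hn as ->; [|now left]. f_equal.
        apply IH; [|exact Hl]. intros w n Hw. apply H. now right.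
      * intros ->. constructor; [apply H; [now left|reflexivity]|].
        apply IH; [|reflexivity]. intros w n Hw. apply H. now right.
  - split; [now intros -> | apply list_code_inj].
Qed.

(** A derivable <|f, v|> says that the formula coded by [f] has truth value [v].
    Carrying the falsehoods along as well keeps the rule positive, so that
    negation needs no complement. *)
Definition sat_rule (z : nat) (X : nat -> Prop) (j : nat) : Prop :=
  exists f v, j = <|f, v|> /\
  ((exists x y, f = <|0, x, y|> /\ exists m n,
      value (pi2 z) x m /\ value (pi2 z) y n /\
      ((m = n /\ v = 1) \/ (m <> n /\ v = 0))) \/
   (exists i vs, f = <|1, i, vs|> /\ exists b,
      all2 (value (pi2 z)) vs b /\ rel_code (pi1 z) i b v) \/
   (exists g, f = <|2, g|> /\
      ((X <|g, 0|> /\ v = 1) \/ (X <|g, 1|> /\ v = 0))) \/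
   (exists g h, f = <|3, g, h|> /\
      (((X <|g, 1|> /\ X <|h, 1|>) /\ v = 1) \/
       ((X <|g, 0|> \/ X <|h, 0|>) /\ v = 0))) \/
   (exists g h, f = <|4, g, h|> /\
      (((X <|g, 1|> \/ X <|h, 1|>) /\ v = 1) \/
       ((X <|g, 0|> /\ X <|h, 0|>) /\ v = 0))) \/
   (exists g h, f = <|5, g, h|> /\
      (((X <|g, 0|> \/ X <|h, 1|>) /\ v = 1) \/
       ((X <|g, 1|> /\ X <|h, 0|>) /\ v = 0)))).

Definition truth (z f v : nat) : Prop := derivable (sat_rule z) <|f, v|>.

Lemma sat_rule_continuous z h : continuous (fun X => sat_rule z X h).
Proof. unfold sat_rule. computability. Qed.

Lemma sigma1_sort_code f g h :
  computable f -> computable g -> computable h ->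
  sigma1 (fun x => sort_code (f x) (g x) (h x)).
Proof. intros. unfold sort_code. computability. Qed.

Lemma sigma1_rel_code f g h i :
  computable f -> computable g -> computable h -> computable i ->
  sigma1 (fun x => rel_code (f x) (g x) (h x) (i x)).
Proof. intros. unfold rel_code. computability. Qed.

Lemma sigma1_value f g h :
  computable f -> computable g -> computable h ->
  sigma1 (fun x => value (f x) (g x) (h x)).
Proof. intros. unfold value. computability. Qed.
Hint Resolve sigma1_sort_code sigma1_rel_code sigma1_value : computability.

Lemma sigma1_truth f g h :
  computable f -> computable g -> computable h ->
  sigma1 (fun x => truth (f x) (g x) (h x)).
Proof.
  intros. unfold truth. apply (sigma1_derivable sat_rule).
  - apply sat_rule_continuous.
  - unfold sat_rule. computability.
  - computability.
  - computability.
Qed.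
Hint Resolve sigma1_truth : computability.

Lemma truth_unfold z f v : truth z f v <-> sat_rule z (derivable (sat_rule z)) <|f, v|>.
Proof. apply derivable_unfold, sat_rule_continuous. Qed.

(** For each connective the tags leave a single clause of the rule, whose
    premises speak of the immediate subformulas. *)
Lemma truth_spec c L M z s f :
  CompStr c L M -> quantifier_free f ->
  (forall v n, occurs_free v f -> value z (var_code v) n <-> n = s v) ->
  (truth <|c, z|> (formula_code f) 1 <-> sat M s f) /\
  (truth <|c, z|> (formula_code f) 0 <-> ~ sat M s f).
Proof.
  intros HC. induction f as [v w|i vs|g IHg|g IHg h IHh|g IHg h IHh|g IHg h IHh|v g _|v g _];
    simpl; intros Hq Hz; try contradiction.
  - assert (E : forall t, truth <|c, z|> <|0, var_code v, var_code w|> t <->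
                (s v = s w /\ t = 1) \/ (s v <> s w /\ t = 0)).
    { intros t. rewrite truth_unfold. split.
      - intros H. unfold sat_rule in H. unpair. tags;
          repeat match goal with H : value z _ _ |- _ => apply Hz in H; [|tauto] end;
          subst; tauto.
      - intros H. exists <|0, var_code v, var_code w|>, t. split; [reflexivity|].
        left. do 2 eexists. split; [reflexivity|]. exists (s v), (s w). unpair.
        rewrite !Hz by tauto. tauto. }
    rewrite !E. split; split; (intuition discriminate).
  - assert (E : forall t, truth <|c, z|> <|1, i, vars_code vs|> t <->
                rel_code c i (list_code (map s vs)) t).
    { intros t. rewrite truth_unfold. split.
      - intros H. unfold sat_rule in H. unpair. tags.
        match goal with H : all2 _ _ _ |- _ =>
          apply (all2_value _ s) in H; [now subst|exact Hz] end.
      - intros H. exists <|1, i, vars_code vs|>, t. split; [reflexivity|].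
        right. left. do 2 eexists. split; [reflexivity|]. unpair.
        exists (list_code (map s vs)). split; [|exact H]. now apply (all2_value z s). }
    rewrite !E. now apply (rel_code_spec c L).
  - destruct IHg as [I1 I0]; auto.
    assert (E : forall t, truth <|c, z|> <|2, formula_code g|> t <->
                (truth <|c, z|> (formula_code g) 0 /\ t = 1) \/
                (truth <|c, z|> (formula_code g) 1 /\ t = 0)).
    { intros t. rewrite truth_unfold. split.
      - intros H. unfold sat_rule in H. tags; [left|right]; now split.
      - intros H. do 2 eexists. split; [reflexivity|].
        do 2 right. left. eexists. now split. }
    rewrite !E, I1, I0. split; split; try (intuition discriminate).
    intros H. right. split; [now apply NNPP | reflexivity].
  - destruct Hq as [Hqg Hqh].
    destruct IHg as [I1 I0]; auto. destruct IHh as [J1 J0]; auto.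
    assert (E : forall t, truth <|c, z|> <|3, formula_code g, formula_code h|> t <->
       ((truth <|c, z|> (formula_code g) 1 /\ truth <|c, z|> (formula_code h) 1) /\ t = 1) \/
       ((truth <|c, z|> (formula_code g) 0 \/ truth <|c, z|> (formula_code h) 0) /\ t = 0)).
    { intros t. rewrite truth_unfold. split.
      - intros H. unfold sat_rule in H. tags; unfold truth; tauto.
      - intros H. do 2 eexists. split; [reflexivity|].
        do 3 right. left. do 2 eexists. now split. }
    rewrite !E, I1, I0, J1, J0.
    destruct (classic (sat M s g)), (classic (sat M s h)); intuition discriminate.
  - destruct Hq as [Hqg Hqh].
    destruct IHg as [I1 I0]; auto. destruct IHh as [J1 J0]; auto.
    assert (E : forall t, truth <|c, z|> <|4, formula_code g, formula_code h|> t <->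
       ((truth <|c, z|> (formula_code g) 1 \/ truth <|c, z|> (formula_code h) 1) /\ t = 1) \/
       ((truth <|c, z|> (formula_code g) 0 /\ truth <|c, z|> (formula_code h) 0) /\ t = 0)).
    { intros t. rewrite truth_unfold. split.
      - intros H. unfold sat_rule in H. tags; unfold truth; tauto.
      - intros H. do 2 eexists. split; [reflexivity|].
        do 4 right. left. do 2 eexists. now split. }
    rewrite !E, I1, I0, J1, J0.
    destruct (classic (sat M s g)), (classic (sat M s h)); intuition discriminate.
  - destruct Hq as [Hqg Hqh].
    destruct IHg as [I1 I0]; auto. destruct IHh as [J1 J0]; auto.
    assert (E : forall t, truth <|c, z|> <|5, formula_code g, formula_code h|> t <->
       ((truth <|c, z|> (formula_code g) 0 \/ truth <|c, z|> (formula_code h) 1) /\ t = 1) \/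
       ((truth <|c, z|> (formula_code g) 1 /\ truth <|c, z|> (formula_code h) 0) /\ t = 0)).
    { intros t. rewrite truth_unfold. split.
      - intros H. unfold sat_rule in H. tags; unfold truth; tauto.
      - intros H. do 2 eexists. split; [reflexivity|].
        do 5 right. do 2 eexists. now split. }
    rewrite !E, I1, I0, J1, J0.
    destruct (classic (sat M s g)), (classic (sat M s h)); intuition discriminate.
Qed.

(** * Solution sets *)

Definition typed (c a vs : nat) : Prop :=
  all2 (fun x v => sort_code c x (pi1 v)) a vs.

Definition sol (c phi a b : nat) : Prop :=
  typed c b (pi2 (pi2 phi)) /\
  truth <|c, <|pi1 (pi2 phi), a|>, pi2 (pi2 phi), b|> (pi1 phi) 1.

Lemma sigma1_typed f g h :
  computable f -> computable g -> computable h ->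
  sigma1 (fun x => typed (f x) (g x) (h x)).
Proof. intros. unfold typed. computability. Qed.
Hint Resolve sigma1_typed : computability.

Lemma sigma1_sol f g h i :
  computable f -> computable g -> computable h -> computable i ->
  sigma1 (fun x => sol (f x) (g x) (h x) (i x)).
Proof. intros. unfold sol. computability. Qed.
Hint Resolve sigma1_sol : computability.

Lemma typed_spec c L M a vs :
  CompStr c L M -> typed c (list_code a) (vars_code vs) <-> same_type M a vs.
Proof.
  intros HC. unfold typed, vars_code, same_type. rewrite all2_code.
  revert vs; induction a as [|x a IH]; intros [|v vs]; simpl;
    split; intros H; inversion H; subst; constructor.
  - unfold var_code in *. unpair. now apply (sort_code_spec c L M).
  - now apply IH.
  - unfold var_code in *. unpair. now apply (sort_code_spec c L M).
  - now apply IH.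
Qed.

Lemma sol_spec c L M phi a b :
  CompStr c L M -> qf_pformula L phi -> same_type M a (xvars phi) ->
  sol c (pformula_code phi) (list_code a) (list_code b) <-> solution M phi a b.
Proof.
  intros HC [[_ [Hnd Hv]] Hq] Ha. unfold sol, solution, pformula_code. unpair.
  rewrite (typed_spec c L M b (yvars phi)) by exact HC.
  split; intros [Hb H]; (split; [exact Hb|]);
    eapply (truth_spec c L M); eauto; intros v n Hf; apply Hv in Hf;
    rewrite value_assignment
      by (auto; symmetry; eapply Forall2_length; eassumption);
    tauto.
Qed.

Lemma vars_code_inj vs ws : vars_code vs = vars_code ws -> vs = ws.
Proof.
  intros H. apply list_code_inj in H. revert ws H.
  induction vs as [|v vs IH]; intros [|w ws] H; try discriminate; [reflexivity|].
  injection H as H H'. f_equal; auto using var_code_inj.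
Qed.

Lemma formula_code_inj f g : formula_code f = formula_code g -> f = g.
Proof.
  revert g; induction f; intros [] H; simpl in H; pairs;
    f_equal; auto using var_code_inj, vars_code_inj.
Qed.

Lemma pformula_code_inj phi psi : pformula_code phi = pformula_code psi -> phi = psi.
Proof.
  destruct phi, psi. unfold pformula_code. simpl. intros H. pairs.
  f_equal; auto using formula_code_inj, vars_code_inj.
Qed.

Lemma DCL0_code L M phi a :
  qf_pformula L phi -> same_type M a (xvars phi) ->
  DCL0 L M <|pformula_code phi, list_code a|> <-> exists! b, solution M phi a b.
Proof.
  intros Hphi Ha. split.
  - intros (psi & a' & E & _ & _ & H). apply pair_inj in E as [E1 E2].
    apply pformula_code_inj in E1. apply list_code_inj in E2. now subst.
  - intros H. exists phi, a. auto.
Qed.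

(** The uniqueness claim as a semidecidable condition on [b] together with the
    complement of another one. *)
Lemma unique_solution_code c L M phi a :
  CompStr c L M -> qf_pformula L phi -> same_type M a (xvars phi) ->
  (exists b, sol c (pformula_code phi) (list_code a) b /\
     ~ exists b', b' <> b /\ sol c (pformula_code phi) (list_code a) b') <->
  exists! b, solution M phi a b.
Proof.
  intros HC Hphi Ha.
  assert (E : forall b, sol c (pformula_code phi) (list_code a) (list_code b) <->
                        solution M phi a b) by (intros; now apply (sol_spec c L M)).
  split.
  - intros [n [Hb Hu]]. destruct (list_code_surj n) as [b ->]. exists b.
    split; [now apply E|]. intros b' Hb'. apply NNPP. intros N. apply Hu.
    exists (list_code b'). split; [|now apply E].
    intros E'. apply list_code_inj in E'. congruence.
  - intros [b [Hb Hu]]. exists (list_code b). split; [now apply E|].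
    intros [n [N Hn]]. destruct (list_code_surj n) as [b' ->].
    apply N. f_equal. symmetry. apply Hu. now apply E.
Qed.

(** * Derivations of membership in the closure *)

(** Stating both values of a binary digit existentially makes membership in a
    finite set and its negation semidecidable alike. *)
Definition bit (v u x : nat) : Prop :=
  exists q r, r < 2 ^ x /\ u = r + (v + 2 * q) * 2 ^ x.

Lemma bit_testbit b u x : bit (Nat.b2n b) u x <-> Nat.testbit u x = b.
Proof.
  split.
  - intros (q & r & Hr & E). now apply (Nat.testbit_unique u x b r q).
  - intros <-. destruct (Nat.testbit_spec u x) as (r & q & Hr & E).
    exists q, r. split; [lia|exact E].
Qed.

Lemma fin_set_lt u x : fin_set u x -> x < u.
Proof.
  intros H. apply (bit_testbit true) in H as (q & r & _ & E). cbn [Nat.b2n] in E.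
  assert (x < 2 ^ x) by (apply Nat.pow_gt_lin_r; lia). nia.
Qed.

Lemma sigma1_bit v f g :
  computable f -> computable g -> sigma1 (fun x => bit v (f x) (g x)).
Proof. intros. unfold bit. computability. Qed.
Hint Resolve sigma1_bit : computability.

(** [z] is [<| <| <|c, e|>, u|>, l|>]: the codes of the structure and of the set of
    formulas, the canonical index of the base, and a list of pairs (formula,
    parameters).  The rule trusts [l], taking for granted that each formula
    listed there has at most one solution for its parameters. *)
Definition dcl_rule (z : nat) (X : nat -> Prop) (h : nat) : Prop :=
  bit 1 (pi2 (pi1 z)) h \/
  exists phi a b,
    yields (pi2 (pi1 (pi1 z))) phi 1 /\ all X a /\
    typed (pi1 (pi1 (pi1 z))) a (pi1 (pi2 phi)) /\ mem <|phi, a|> (pi2 z) /\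
    sol (pi1 (pi1 (pi1 z))) phi a b /\ mem h b.

Lemma dcl_rule_continuous z h : continuous (fun X => dcl_rule z X h).
Proof. unfold dcl_rule, all, all_suffixes. computability. Qed.

Definition derives (k u l h : nat) : Prop :=
  derivable (dcl_rule <| <|k, u|>, l|>) h.

Lemma derives_unfold k u l h :
  derives k u l h <-> dcl_rule <| <|k, u|>, l|> (derives k u l) h.
Proof. apply derivable_unfold, dcl_rule_continuous. Qed.

Lemma sigma1_derives f g h i :
  computable f -> computable g -> computable h -> computable i ->
  sigma1 (fun x => derives (f x) (g x) (h x) (i x)).
Proof.
  intros. unfold derives. apply (sigma1_derivable dcl_rule).
  - apply dcl_rule_continuous.
  - unfold dcl_rule. computability.
  - computability.
  - computability.
Qed.
Hint Resolve sigma1_derives : computability.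

Lemma derives_mono k u l l' h :
  incl l l' -> derives k u (list_code l) h -> derives k u (list_code l') h.
Proof.
  intros Hl. unfold derives at 1. revert h.
  apply derivable_least; [apply dcl_rule_continuous|].
  intros h H. apply derives_unfold. unfold dcl_rule in *. unpair.
  destruct H as [H|(phi & a & b & He & Ha & Ht & Hm & H)]; [now left|right].
  exists phi, a, b. rewrite mem_code in *. apply Hl in Hm. tauto.
Qed.

Lemma cl_mono Phi M m n B b : m <= n -> cl Phi M m B b -> cl Phi M n B b.
Proof.
  induction 1; [auto|]. intros H'. simpl. left. auto.
Qed.

Lemma dcl_all Phi M B a : Forall (dcl Phi M B) a -> exists m, Forall (cl Phi M m B) a.
Proof.
  induction 1 as [|x a [m Hm] _ [n Hn]]; [now exists 0|].
  exists (m + n). constructor; [apply (cl_mono _ _ m); [lia|exact Hm]|].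
  eapply Forall_impl; [|exact Hn]. intros y. apply cl_mono. lia.
Qed.

(** Derivations of finitely many elements can be made to rely on a common list
    of claims, since a longer list does no harm. *)
Lemma derives_all Q k u a :
  Forall (fun h => exists l, Forall Q l /\ derives k u (list_code l) h) a ->
  exists l, Forall Q l /\ Forall (derives k u (list_code l)) a.
Proof.
  induction 1 as [|h a (l & Hl & Hh) _ (l' & Hl' & Ha)]; [now exists []|].
  exists (l ++ l'). split; [now apply Forall_app|]. constructor.
  - apply (derives_mono _ _ l); auto using incl_appl, incl_refl.
  - eapply Forall_impl; [|exact Ha].
    intros y. apply derives_mono. auto using incl_appr, incl_refl.
Qed.

(** The oracle is used only positively: membership in the closure amounts to a
    derivation together with the truth of finitely many uniqueness claims.
    Every [Q] that decides those claims correctly for the formulas in [Phi] may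
    stand for the oracle. *)
Lemma dcl_iff_derives c e L M Phi (Q : nat -> Prop) u h :
  CompStr c L M -> formula_set_code L e Phi ->
  (forall phi a, Phi phi -> same_type M a (xvars phi) ->
     Q <|pformula_code phi, list_code a|> <-> exists! b, solution M phi a b) ->
  dcl Phi M (fin_set u) h <-> exists l, derives <|c, e|> u l h /\ all Q l.
Proof.
  intros HC [Hqf HPhi] HQ. pose proof (decides_yields _ _ HPhi) as He. split.
  - intros [m Hm].
    enough (exists l, Forall Q l /\ derives <|c, e|> u (list_code l) h)
      as (l & Hl & H) by (exists (list_code l); now rewrite all_code).
    revert h Hm. induction m as [|m IH]; intros h Hm.
    + exists []. split; [constructor|]. apply derives_unfold. left. unpair.
      now apply (bit_testbit true).
    + destruct Hm as [Hm|(phi & a & Hphi & Ha & Ht & Hu & b & Hb & Hs)].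
      { now apply IH. }
      destruct (derives_all Q <|c, e|> u a) as (l & Hl & Hd).
      { eapply Forall_impl; [|exact Ha]. apply IH. }
      exists (<|pformula_code phi, list_code a|> :: l). split.
      { constructor; [now apply HQ | exact Hl]. }
      apply derives_unfold. right.
      exists (pformula_code phi), (list_code a), (list_code b). unpair.
      rewrite all_code, !mem_code.
      split; [apply He; eauto|]. split.
      { eapply Forall_impl; [|exact Hd]. intros y. apply derives_mono, incl_tl, incl_refl. }
      split.
      { unfold pformula_code. unpair. now apply (typed_spec c L M). }
      split; [now left|]. split; [|exact Hb]. apply (sol_spec c L M); auto.
  - intros (l & H & Hl). revert h H. unfold derives.
    apply derivable_least; [apply dcl_rule_continuous|].
    intros h [H|(phi & a & b & Hphi & Ha & Ht & Hm & Hs & Hh)]; unpair.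
    + exists 0. now apply (bit_testbit true).
    + apply He in Hphi as (psi & -> & Hpsi).
      destruct (list_code_surj a) as [a' ->], (list_code_surj b) as [b' ->],
        (list_code_surj l) as [l' ->].
      rewrite all_code, mem_code in *.
      unfold pformula_code in Ht. unpair.
      apply (typed_spec c L M) in Ht; [|exact HC].
      destruct (dcl_all _ _ _ _ Ha) as [m Ha'].
      exists (S m). right. exists psi, a'. repeat split; auto.
      * apply HQ; auto. rewrite Forall_forall in Hl. now apply Hl.
      * exists b'. split; [exact Hh|]. apply (sol_spec c L M); auto.
Qed.

(** [q] is [<| <|c, e|>, <|a, u|> |>].  The first conjunct says that the set with
    canonical index [u] lies inside the structure: an element is recognised by
    having a sort. *)
Definition based_derivation (q l : nat) : Prop :=
  (forall h, h < pi2 (pi2 q) ->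
     bit 0 (pi2 (pi2 q)) h \/ exists j, sort_code (pi1 (pi1 q)) h j) /\
  derives (pi1 q) (pi2 (pi2 q)) l (pi1 (pi2 q)).

Lemma sigma1_based_derivation f g :
  computable f -> computable g ->
  sigma1 (fun q => based_derivation (f q) (g q)).
Proof. intros. unfold based_derivation. computability. Qed.
Hint Resolve sigma1_based_derivation : computability.

Lemma dcl_pairs_iff c e L M Phi (Q : nat -> Prop) n :
  CompStr c L M -> formula_set_code L e Phi ->
  (forall phi a, Phi phi -> same_type M a (xvars phi) ->
     Q <|pformula_code phi, list_code a|> <-> exists! b, solution M phi a b) ->
  dcl_pairs Phi M n <->
  exists l, based_derivation <| <|c, e|>, n|> l /\ all Q l.
Proof.
  intros HC He HQ. rewrite <- (pair_pi n).
  generalize (pi1 n) as a, (pi2 n) as u. clear n. intros a u.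
  assert (Hu : (forall x, fin_set u x -> univ M x) <->
     (forall h, h < u -> bit 0 u h \/ exists j, sort_code c h j)).
  { assert (HM : structure_wf L M).
    { destruct (structure_yields _ _ _ HC) as (d & _ & H & _). exact H. }
    split.
    - intros H h _. destruct (Nat.testbit u h) eqn:E.
      + right. destruct (sort_unique _ _ HM h (H h E)) as [j [Hj _]].
        exists j. now apply (sort_code_spec c L M).
      + left. now apply (bit_testbit false).
    - intros H x Hx. destruct (H x (fin_set_lt u x Hx)) as [H0|[j Hj]].
      + apply (bit_testbit false) in H0. unfold fin_set in Hx. congruence.
      + apply (sort_code_spec c L M) in Hj; [|exact HC].
        now apply (sort_sound _ _ HM) in Hj. }
  pose proof (dcl_iff_derives c e L M Phi Q u a HC He HQ) as Hd.
  transitivity ((forall x, fin_set u x -> univ M x) /\ dcl Phi M (fin_set u) a).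
  - split.
    + intros (a' & u' & E & H). apply pair_inj in E as [-> ->]. exact H.
    + intros H. now exists a, u.
  - rewrite Hu, Hd. unfold based_derivation. unpair. split.
    + intros [H (l & Hl & HQl)]. now exists l.
    + intros (l & [H Hl] & HQl). split; [exact H|]. now exists l.
Qed.

(** Finite choice: the witnesses move out of the bounded quantifier, which would
    otherwise separate the existential quantifier in front from them. *)
Lemma all_ex_iff_all2 (P N : nat -> nat -> Prop) c :
  all (fun n => exists b, P n b /\ ~ N n b) c <->
  exists d, all2 P c d /\ ~ exists n b, zip_mem n b c d /\ N n b.
Proof.
  destruct (list_code_surj c) as [l ->]. rewrite all_code. split.
  - intros H.
    enough (exists d, Forall2 P l d /\ forall n b, In (n, b) (combine l d) -> ~ N n b)
      as (d & Hd & Hn).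
    { exists (list_code d). rewrite all2_code. split; [exact Hd|].
      intros (n & b & Hz & HN). rewrite zip_mem_code in Hz. now apply (Hn n b). }
    induction H as [|n l (b & Hb & HN) _ (d & Hd & Hn)].
    + exists []. split; [constructor|easy].
    + exists (b :: d). split; [now constructor|].
      intros n' b' [E|H]; [now injection E as <- <-|now apply Hn].
  - intros (d & H & HN). destruct (list_code_surj d) as [m ->].
    rewrite all2_code in H.
    assert (Hn : forall n b, In (n, b) (combine l m) -> ~ N n b).
    { intros n b Hz Hnb. apply HN. exists n, b. now rewrite zip_mem_code. }
    clear HN. induction H as [|n b l m Hb _ IH]; constructor.
    + exists b. split; [exact Hb|]. apply Hn. now left.
    + apply IH. intros n' b' H. apply Hn. now right.
Qed.

(** * The two bounds *)

Lemma dcl_pairs_sigma1_in_DCL0 :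
  exists s, computable s /\
    forall c L M e Phi, CompStr c L M -> formula_set_code L e Phi ->
      sigma_index (DCL0 L M) 1 (s <|c, e|>) (dcl_pairs Phi M).
Proof.
  destruct (sigma_index_1 based_derivation) as [s [Hs H]]; [computability|].
  exists s. split; [exact Hs|]. intros c L M e Phi HC He. apply H. intros n.
  apply (dcl_pairs_iff c e L M); auto.
  intros phi a Hphi. apply DCL0_code. now apply He.
Qed.

Lemma dcl_pairs_sigma2 :
  exists s, computable s /\
    forall c L M e Phi, CompStr c L M -> formula_set_code L e Phi ->
      sigma_index no_oracle 2 (s <|c, e|>) (dcl_pairs Phi M).
Proof.
  pose (P := fun c n b => sol c (pi1 n) (pi2 n) b).
  pose (N := fun c n b => exists b', b' <> b /\ sol c (pi1 n) (pi2 n) b').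
  destruct (sigma_index_2
    (fun q y => based_derivation q (pi1 y) /\
                all2 (P (pi1 (pi1 q))) (pi1 y) (pi2 y))
    (fun q y => exists n b, zip_mem n b (pi1 y) (pi2 y) /\ N (pi1 (pi1 q)) n b))
    as [s [Hs H]]; [unfold P, N; computability ..|].
  exists s. split; [exact Hs|]. intros c L M e Phi HC He. apply H. intros n.
  rewrite (dcl_pairs_iff c e L M Phi (fun m => exists b, P c m b /\ ~ N c m b)); auto.
  - unpair. split.
    + intros (l & Hl & HQ). apply all_ex_iff_all2 in HQ as (d & Hd & HN).
      exists <|l, d|>. unpair. tauto.
    + intros (y & (Hl & Hd) & HN). exists (pi1 y). split; [exact Hl|].
      apply all_ex_iff_all2. now exists (pi2 y).
  - intros phi a Hphi Ha. unfold P, N. unpair.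
    apply (unique_solution_code c L); auto. now apply He.
Qed.

Theorem proposition3p4 :
  (exists f : nat -> nat -> nat,
     computable2 f /\
     forall (c : nat) (L : language) (M : structure) (e : nat) (Phi : pformula -> Prop),
       CompStr c L M ->
       formula_set_code L e Phi ->
       sigma_index (DCL0 L M) 1 (f c e) (dcl_pairs Phi M)) /\
  (exists g : nat -> nat -> nat,
     computable2 g /\
     forall (c : nat) (L : language) (M : structure) (e : nat) (Phi : pformula -> Prop),
       CompStr c L M ->
       formula_set_code L e Phi ->
       sigma_index no_oracle 2 (g c e) (dcl_pairs Phi M)).
Proof.
  split.
  - destruct dcl_pairs_sigma1_in_DCL0 as [s [Hs H]].
    exists (fun c e => s <|c, e|>). split; [now apply computable2_of | exact H].
  - destruct dcl_pairs_sigma2 as [s [Hs H]].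
    exists (fun c e => s <|c, e|>). split; [now apply computable2_of | exact H].
Qed.
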